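(* Let $\mathcal{X}$ be a (real or complex) Banach space with $\dim \mathcal{X}\geq 2$, let $\mathcal{N}$ be a nest on $\mathcal{X}$ such that each $N\in\mathcal{N}$ with $N_{-}=N$ is complemented in $\mathcal{X}$, and let $\delta,\tau: Alg\mathcal{N}\rightarrow Alg\mathcal{N}$ be linear maps. Then $\delta(A)B+A\tau(B)=0$ for all $A,B\in Alg\mathcal{N}$ with $AB=0$ if and only if there exist $R,S,T\in Alg\mathcal{N}$ such that $\delta(A)=RA+AS$ and $\tau(A)=-SA+AT$ for all $A\in Alg\mathcal{N}$.
   Context: A nest $\mathcal{N}$ on a Banach space $\mathcal{X}$ is a chain (under inclusion) of norm-closed subspaces of $\mathcal{X}$ containing $\{0\}$ and $\mathcal{X}$ such that for every family $\{N_i\}$ of elements of $\mathcal{N}$, both $\bigcap N_i$ and $\bigvee N_i$ (the closed linear span of the $N_i$) belong to $\mathcal{N}$. The nest algebra $Alg\mathcal{N}$ is the algebra of all bounded linear operators on $\mathcal{X}$ that leave every member of $\mathcal{N}$ invariant. For $N\in\mathcal{N}$, $N_{-}:=\bigvee\{M\in\mathcal{N} : M\subsetneq N\}$. Linear maps are linear over the scalar field of $\mathcal{X}$ and are not assumed continuous. *)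

(* Defs.v *)
From HB Require Import structures.
From mathcomp Require Import all_boot all_order all_algebra.
From mathcomp Require Import complex.
From mathcomp Require Import boolp classical_sets functions reals.
From mathcomp Require Import topology normedtype.

Set Implicit Arguments.
Unset Strict Implicit.
Unset Printing Implicit Defensive.

Import Order.TTheory GRing.Theory Num.Theory.
Import numFieldNormedType.Exports.

Local Open Scope classical_set_scope.
Local Open Scope ring_scope.

(* The structure normedModType is indexed by the scalar field and its norm
   takes values in that field: over R[i], `|x| is a real nonnegative element
   of R[i], since 0 <= z in R[i] forces the imaginary part of z to be 0. *)
Variant scalar_kind := RealScalars | ComplexScalars.

Definition scalars (R : realType) (k : scalar_kind) : numFieldType :=
  match k with
  | RealScalars => R
  | ComplexScalars => R[i]
  end.

Section Subspaces.
Variables (K : numFieldType) (X : normedModType K).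
Implicit Types (M L S : set X) (F : set (set X)).

Definition linear_subspace M :=
  M 0 /\ forall (a : K) (x y : X), M x -> M y -> M (a *: x + y).

Definition closed_subspace M := linear_subspace M /\ closed M.

Definition linear_span S : set X :=
  [set x | exists (n : nat) (a : 'I_n -> K) (v : 'I_n -> X),
     (forall i, S (v i)) /\ x = \sum_(i < n) a i *: v i].

Definition closed_span S : set X := closure (linear_span S).

(* \bigvee F; it is {0} when F is empty. *)
Definition closed_join F : set X := closed_span (\bigcup_(M in F) M).

Definition complemented M :=
  exists L, [/\ closed_subspace L, M `&` L = [set 0] &
    forall x, exists y z, [/\ M y, L z & x = y + z]].

Definition bounded_operator (f : X -> X) :=
  linear f /\ exists C : K, forall x, `|f x| <= C * `|x|.

End Subspaces.

Definition dim_ge2 (K : numFieldType) (X : lmodType K) :=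
  exists u v : X, forall a b : K, a *: u + b *: v = 0 -> a = 0 /\ b = 0.

Record nest (K : numFieldType) (X : normedModType K) := Nest {
  in_nest :> set X -> Prop;
  nest_closed : forall M, in_nest M -> closed_subspace M;
  nest_chain : forall M L, in_nest M -> in_nest L -> M `<=` L \/ L `<=` M;
  nest0 : in_nest [set 0];
  nestT : in_nest [set: X];
  nest_bigcap : forall F : set (set X), F `<=` in_nest ->
    in_nest (\bigcap_(M in F) M);
  nest_join : forall F : set (set X), F `<=` in_nest ->
    in_nest (closed_join F)
}.

(* The member N_- of the nest, for N = M. *)
Definition nest_pred (K : numFieldType) (X : normedModType K) (N : nest X)
  (M : set X) : set X := closed_join [set L | N L /\ L `<` M].

Section NestAlgebra.
Variables (K : numFieldType) (X : normedModType K) (N : nest X).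

Definition nest_operator : {pred X -> X} := fun f =>
  `[< bounded_operator f /\ forall M, N M -> forall x, M x -> M (f x) >].

Lemma nest_operatorP (f : X -> X) :
  reflect (bounded_operator f /\ forall M, N M -> forall x, M x -> M (f x))
          (f \in nest_operator).
Proof. exact: asboolP. Qed.

Record nest_alg := NestAlg {
  nest_alg_fun :> X -> X;
  nest_algP : nest_alg_fun \in nest_operator
}.

HB.instance Definition _ := [isSub for nest_alg_fun].
HB.instance Definition _ := [Choice of nest_alg by <:].

Lemma nest_operator_submod : GRing.submod_closed nest_operator.
Proof.
split.
  apply/nest_operatorP; split; last first.
    by move=> M /nest_closed[[M0 _] _] x _.
  split; first by move=> a x y /=; rewrite scaler0 addr0.
  by exists 0 => x; rewrite normr0 mul0r.
move=> a f g /nest_operatorP[[lf [C fC]] fN] /nest_operatorP[[lg [D gD]] gN].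
apply/nest_operatorP; split; last first.
  move=> M NM x Mx; have [[_ Mlin] _] := nest_closed NM.
  by apply: Mlin; [exact: fN|exact: gN].
split.
  move=> b x y; rewrite !fctE /= lf lg !scalerDr !scalerA addrACA.
  by rewrite [a * b]mulrC.
exists (`|a| * C + D) => x; rewrite !fctE (le_trans (ler_normD _ _))//.
rewrite mulrDl lerD ?gD// normrZ -mulrA ler_wpM2l// fC.
Qed.

HB.instance Definition _ :=
  GRing.SubChoice_isSubLmodule.Build K (X -> X) nest_operator nest_alg
    nest_operator_submod.

Lemma nest_operator_id : (idfun : X -> X) \in nest_operator.
Proof.
apply/nest_operatorP; split=> //; split=> //.
by exists 1 => x; rewrite mul1r.
Qed.

Lemma nest_operator_comp (A B : nest_alg) : A \o B \in nest_operator.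
Proof.
have /nest_operatorP[[lA [C AC]] AN] := nest_algP A.
have /nest_operatorP[[lB [D BD]] BN] := nest_algP B.
apply/nest_operatorP; split; last by move=> M NM x Mx; exact: (AN _ NM _ (BN _ NM _ Mx)).
split; first by move=> a x y /=; rewrite lB lA.
exists (`|C| * D) => x /=; apply: le_trans (AC _) _.
rewrite -(ger0_norm (le_trans (normr_ge0 _) (AC (B x)))) normrM normr_id.
by rewrite -mulrA ler_wpM2l.
Qed.

Definition nest_alg_one := NestAlg nest_operator_id.
Definition nest_alg_mul (A B : nest_alg) := NestAlg (nest_operator_comp A B).

Lemma nest_alg_mulA : associative nest_alg_mul.
Proof. by move=> A B C; apply: val_inj. Qed.
Lemma nest_alg_mul1l : left_id nest_alg_one nest_alg_mul.
Proof. by move=> A; apply: val_inj. Qed.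
Lemma nest_alg_mul1r : right_id nest_alg_one nest_alg_mul.
Proof. by move=> A; apply: val_inj. Qed.
Lemma nest_alg_mulDl : left_distributive nest_alg_mul +%R.
Proof. by move=> A B C; apply: val_inj. Qed.
Lemma nest_alg_mulDr : right_distributive nest_alg_mul +%R.
Proof.
move=> A B C; apply: val_inj; apply/funext => x /=.
have /nest_operatorP[[lA _] _] := nest_algP A.
by have := lA 1 (B x) (C x); rewrite !scale1r.
Qed.

(* The product is composition; the ring may be trivial, hence pzRingType. *)
HB.instance Definition _ := GRing.Zmodule_isPzRing.Build nest_alg
  nest_alg_mulA nest_alg_mul1l nest_alg_mul1r nest_alg_mulDl nest_alg_mulDr.

End NestAlgebra.

Arguments nest_alg {K X} N.

(* Main.v *)
Require Import Defs.
From HB Require Import structures.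
From mathcomp Require Import all_boot all_order all_algebra.
From mathcomp Require Import complex.
From mathcomp Require Import boolp classical_sets functions reals.
From mathcomp Require Import topology normedtype.
From mathcomp Require Import lra ring.
Import Order.TTheory GRing.Theory Num.Theory.
Import numFieldNormedType.Exports.
Local Open Scope classical_set_scope.
Local Open Scope ring_scope.

(** Sufficiency is a computation: the terms A S B of delta(A) B and of
    A tau(B) cancel, and the others contain A B.

    For necessity, consider the form phi(A, B) = delta(A) B + A tau(B), which
    vanishes when A B = 0.  Applying this to A E (1 - E) B and to A (1 - E) E B
    gives phi(A E, B) = phi(A, E B) for every idempotent E ([balanced_idem]).
    The elements that can be moved across phi in this way form a subalgebra.
    It contains all rank one operators of the nest algebra
    ([balanced_rank_one]); the complementation hypothesis enters here, to
    provide idempotents with range N when N_- = N.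

    It follows that D(A) = delta(A) - delta(1) A and
    D'(A) = tau(A) - A tau(1) agree on rank one operators, and that
    D(A C) = D(A) C + A D(C) for C of rank one.  The heart of the proof is
    that such a D is inner: D(A) = S A - A S for some S in the algebra.
    Writing rk x f for the operator v |-> f(v) x, the Leibniz rule shows that
    the map x |-> D(rk x f) y, with f(y) = 1, implements D on each member of
    the nest for which rk x f is in the algebra; another choice of f and y
    changes this map by a scalar only ([D_transfer]).
    - If X_- is not X, one f serves for all of X, and the closed graph theorem
      shows that the map is bounded ([inner_of_proper_last]).
    - If X_- = X, the proper members are dense.  A gliding hump argument bounds
      D on rank one operators ([rank_one_bound_exists]); the implementing
      maps, normalized by a scalar, glue to a bounded map on the union of the
      proper members, which extends to X ([inner_of_no_last]).
    In both cases the map leaves each member of the nest invariant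
    ([local_invariant]).

    Finally D' = D, as rank one operators separate points ([tau0_inner]), and
    delta(A) = (delta(1) + S) A - A S, tau(A) = S A + A (tau(1) - S).

    Functionals come from the Hahn-Banach theorem ([separating_functional]) and
    bounded projections from the closed graph theorem ([closed_graph]).  Both
    hold for real and for complex scalars; the estimates use norms that take
    values in the real field. *)

Set Implicit Arguments.
Unset Strict Implicit.
Unset Printing Implicit Defensive.

(** * Scalars and norms with values in the real field *)

Section Scalars.
Variables (F : realType) (k : scalar_kind).
Local Notation K := (scalars F k).

(** The order of F[i] is partial, whereas estimates are easiest in a totally
    ordered field.  All of them are therefore made in F: [ofS] embeds F into
    the scalar field, [reS] retracts it, and the norms [abs] and [nrm] below
    are the given ones read in F. *)
Definition ofS : F -> K :=
  match k with RealScalars => idfun | ComplexScalars => real_complex F end.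

Definition reS : K -> F :=
  match k with RealScalars => idfun | ComplexScalars => @complex.Re F end.

Lemma ofS0 : ofS 0 = 0.
Proof. by rewrite /ofS; case: k => //=; rewrite rmorph0. Qed.

Lemma ofSD (a b : F) : ofS (a + b) = ofS a + ofS b.
Proof. by rewrite /ofS; case: k => //=; rewrite rmorphD. Qed.

Lemma ofSM (a b : F) : ofS (a * b) = ofS a * ofS b.
Proof. by rewrite /ofS; case: k => //=; rewrite rmorphM. Qed.

Lemma ler_ofS (a b : F) : (ofS a <= ofS b) = (a <= b).
Proof. by rewrite /ofS; case: k => //=; rewrite lecR. Qed.

Lemma ltr_ofS (a b : F) : (ofS a < ofS b) = (a < b).
Proof. by rewrite /ofS; case: k => //=; rewrite ltcR. Qed.

Lemma ofSK : cancel ofS reS.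
Proof. by rewrite /ofS /reS; case: k. Qed.

Lemma reSK (z : K) : 0 <= z -> ofS (reS z) = z.
Proof.
rewrite /ofS /reS; case: k z => //= z z0.
by apply/eqP; rewrite eq_complex /= eqxx (ger0_Im z0) eqxx.
Qed.

Lemma normr_ofS (a : F) : `|ofS a| = ofS `|a|.
Proof. by rewrite /ofS; case: k => //=;
  rewrite normc_def /= expr0n addr0 sqrtr_sqr. Qed.

Definition abs (z : K) : F := reS `|z|.

Lemma ofS_abs (z : K) : ofS (abs z) = `|z|.
Proof. by rewrite /abs reSK. Qed.

Lemma abs_ofS (a : F) : abs (ofS a) = `|a|.
Proof. by rewrite /abs normr_ofS ofSK. Qed.

Lemma abs_ge0 z : 0 <= abs z.
Proof. by rewrite -ler_ofS ofS_abs ofS0. Qed.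

Lemma absD x y : abs (x + y) <= abs x + abs y.
Proof. by rewrite -ler_ofS ofSD !ofS_abs ler_normD. Qed.

Lemma absM x y : abs (x * y) = abs x * abs y.
Proof. by apply: (can_inj ofSK); rewrite ofSM !ofS_abs normrM. Qed.

Lemma abs0 : abs 0 = 0.
Proof. by rewrite /abs normr0 -[LHS](ofSK) reSK// -ofS0 ofSK. Qed.

Lemma abs_gt0 x : (0 < abs x) = (x != 0).
Proof. by rewrite -ltr_ofS ofS0 ofS_abs normr_gt0. Qed.

Section Norm.
Variable X : normedModType K.
Implicit Types x y : X.

Definition nrm x : F := reS `|x|.

Lemma ofS_nrm x : ofS (nrm x) = `|x|.
Proof. by rewrite /nrm reSK. Qed.

Lemma nrm_ge0 x : 0 <= nrm x.
Proof. by rewrite -ler_ofS ofS_nrm ofS0. Qed.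

Lemma nrmD x y : nrm (x + y) <= nrm x + nrm y.
Proof. by rewrite -ler_ofS ofSD !ofS_nrm ler_normD. Qed.

Lemma nrmN x : nrm (- x) = nrm x.
Proof. by rewrite /nrm normrN. Qed.

Lemma nrmZ a x : nrm (a *: x) = abs a * nrm x.
Proof. by apply: (can_inj ofSK); rewrite ofSM !ofS_nrm ofS_abs normrZ. Qed.

Lemma nrm0 : nrm 0 = 0.
Proof. by apply: (can_inj ofSK); rewrite ofS_nrm normr0 ofS0. Qed.

Lemma nrm_gt0 x : (0 < nrm x) = (x != 0).
Proof. by rewrite -ltr_ofS ofS0 ofS_nrm normr_gt0. Qed.

Lemma nrmB x y : nrm (x - y) <= nrm x + nrm y.
Proof. by rewrite -[nrm y]nrmN nrmD. Qed.

Lemma nrm_sub x y : nrm (x - y) = nrm (y - x).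
Proof. by rewrite -nrmN opprB. Qed.

Lemma nrm_tri (y x z : X) : nrm (x - z) <= nrm (x - y) + nrm (y - z).
Proof. by apply: le_trans (nrmD _ _); rewrite addrA subrK. Qed.

Lemma nrm_small x : (forall e, 0 < e -> nrm x <= e) -> x = 0.
Proof.
move=> x0; apply/eqP/negPn; rewrite -nrm_gt0; apply/negP => xgt.
by have := x0 (nrm x / 2); lra.
Qed.

Lemma closureP (M : set X) x :
  closure M x <-> forall e, 0 < e -> exists2 y, M y & nrm (x - y) < e.
Proof.
split=> [clM e e0|clM B].
  have /clM[y [My]] : nbhs x (ball x (ofS e)).
    by apply: nbhsx_ballx; rewrite -ofS0 ltr_ofS.
  by rewrite -ball_normE /= -ofS_nrm ltr_ofS => xy; exists y.
move=> /nbhs_ballP[e /= e0]; rewrite -ball_normE => eB.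
have [|y My xy] := clM (reS e).
  by rewrite -ltr_ofS ofS0 reSK// ltW.
exists y; split=> //; apply: eB => /=.
by rewrite -ofS_nrm -[e]reSK ?ltr_ofS// ltW.
Qed.

Lemma closedP (M : set X) x : closed M ->
  (forall e, 0 < e -> exists2 y, M y & nrm (x - y) < e) -> M x.
Proof. by move=> cM /closureP; rewrite -(closure_id M).1. Qed.

Lemma closed_gap (M : set X) x : closed M -> ~ M x ->
  exists2 d, 0 < d & forall y, M y -> d <= nrm (x - y).
Proof.
move=> cM; apply: contra_notP => gap; apply: closedP => // e e0.
apply: contrapT => ney; apply: gap; exists e => // y My.
by rewrite leNgt; apply/negP => lt; apply: ney; exists y.
Qed.

Definition bounded_map (f : X -> X) := exists C : F, forall x, nrm (f x) <= C * nrm x.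

Lemma bounded_mapP (f : X -> X) : bounded_operator f <-> linear f /\ bounded_map f.
Proof.
split=> -[lf [C fC]]; split=> //.
  exists (abs C) => x; rewrite -ler_ofS ofSM !ofS_nrm ofS_abs.
  rewrite -[leRHS]ger0_norm ?mulr_ge0// normrM normr_id -normrM.
  by apply: le_trans (fC x) _; apply: real_ler_norm;
    exact: ger0_real (le_trans _ (fC x)).
by exists (ofS C) => x; rewrite -!ofS_nrm -ofSM ler_ofS.
Qed.

Lemma bounded_map_gt0 (f : X -> X) : bounded_map f ->
  exists2 C : F, 0 < C & forall x, nrm (f x) <= C * nrm x.
Proof.
move=> [C CP]; exists (`|C| + 1) => [|x].
  by have := normr_ge0 C; lra.
apply: le_trans (CP x) _; apply: ler_wpM2r; first exact: nrm_ge0.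
by have := ler_norm C; lra.
Qed.

End Norm.

(** Dyadic scales replace filters in every limit argument below. *)
Lemma half_exp_small (e : F) : 0 < e -> exists n, 2^-1 ^+ n < e.
Proof.
move=> e0; exists (Num.trunc e^-1).+1.
rewrite exprVn invf_plt ?posrE ?exprn_gt0//.
apply: lt_le_trans (truncnS_gt _) _.
by rewrite -natrX ler_nat ltnW// ltn_expl.
Qed.

(** The form in which completeness is used throughout: steps that at least halve
    each time sum to at most twice the first of them, which gives both the
    limit and an explicit error. *)
Lemma fast_cauchy (X : completeNormedModType K) (u : nat -> X) (r : nat -> F) :
  (forall n, 0 < r n) -> (forall n, r n.+1 <= r n / 2) ->
  (forall n, nrm (u n.+1 - u n) <= r n) ->
  exists l, forall n, nrm (l - u n) <= 2 * r n.
Proof.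
move=> r0 rh ur.
have urD n m : nrm (u (n + m)%N - u n) <= 2 * r n - 2 * r (n + m)%N.
  elim: m => [|m IH]; first by rewrite addn0 subrr nrm0; lra.
  have := nrm_tri (u (n + m)%N) (u (n + m.+1)%N) (u n).
  by rewrite addnS; have := ur (n + m)%N; have := rh (n + m)%N; lra.
have rexp n : r n <= r 0 * 2^-1 ^+ n.
  elim: n => [|n IH]; first by rewrite expr0 mulr1.
  by rewrite exprSr mulrA; apply: le_trans (rh n) _; rewrite ler_pM2r ?invr_gt0.
have rsmall (e : F) : 0 < e -> exists n, r n < e.
  move=> e0; have [n ne] := half_exp_small (divr_gt0 e0 (r0 0)).
  by exists n; apply: le_lt_trans (rexp n) _; rewrite mulrC -ltr_pdivlMr.
have cu : cauchy (u @ \oo).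
  apply: cauchy_exP => e e0.
  have re0 : 0 < reS e by rewrite -ltr_ofS ofS0 reSK// ltW.
  have [|n nre] := rsmall (reS e / 2); first lra.
  exists (u n); exists n => // m /= nm.
  rewrite -ball_normE /= -ofS_nrm -[e]reSK ?ltW// ltr_ofS nrm_sub.
  by have := urD n (m - n)%N; rewrite subnKC//; have := r0 m; lra.
have /cvg_ballP ul : cvg (u @ \oo) by exact: cauchy_cvg.
exists (lim (u @ \oo)) => n; apply/ler_addgt0Pr => e e0.
have [|m _ um] := ul (ofS e); first by rewrite -ofS0 ltr_ofS.
have := um (n + m)%N; rewrite /= leq_addl => /(_ isT).
rewrite -ball_normE /= -ofS_nrm ltr_ofS => lt.
have := nrm_tri (u (n + m)%N) (lim (u @ \oo)) (u n).
by have := urD n m; have := r0 (n + m)%N; lra.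
Qed.

End Scalars.

(** * The closed graph theorem *)

Section RawLinear.
Variables (K : numFieldType) (U V : lmodType K) (f : U -> V).
Hypothesis lf : linear f.

Lemma lin0 : f 0 = 0.
Proof. by have := lf (-1) 0 0; rewrite !scaleN1r oppr0 addr0 addNr. Qed.

Lemma linD x y : f (x + y) = f x + f y.
Proof. by have := lf 1 x y; rewrite !scale1r. Qed.

Lemma linZ a x : f (a *: x) = a *: f x.
Proof. by have := lf a x 0; rewrite lin0 !addr0. Qed.

Lemma linN x : f (- x) = - f x.
Proof. by rewrite -scaleN1r linZ scaleN1r. Qed.

Lemma linB x y : f (x - y) = f x - f y.
Proof. by rewrite linD linN. Qed.
End RawLinear.

Section ClosedGraph.
Variables (F : realType) (k : scalar_kind).
Variable X : completeNormedModType (scalars F k).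
Variable T : X -> X.
Hypothesis linT : linear T.
(* The graph is closed: by linearity it suffices to look at limits of points
   (x, T x) with x tending to 0. *)
Hypothesis closedT : forall w,
  (forall e : F, 0 < e -> exists2 x, nrm x < e & nrm (T x - w) < e) -> w = 0.

Let near_ball n := [set x : X |
  forall e : F, 0 < e -> exists2 y, nrm (x - y) < e & nrm (T y) <= n%:R].

(** The sets where |T y| <= n cover X, so one of them is dense in some ball.
    Otherwise nested balls, the n-th of which avoids the n-th set, would
    shrink to a point l with |T l| larger than every n. *)
Lemma closed_graph_baire : exists n x0, exists2 r : F, 0 < r &
  forall x, nrm (x - x0) < r -> near_ball n x.
Proof.
apply: contrapT => nex.
have avoid (p : nat * X * F) : exists q : X * F, 0 < p.2 ->
    [/\ 0 < q.2, q.2 <= p.2 / 2, nrm (q.1 - p.1.2) <= p.2 &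
        forall y, nrm (q.1 - y) <= 2 * q.2 -> p.1.1%:R < nrm (T y)].
  case: p => -[n x] r /=; case: (ltP 0 r) => [r0|_]; last by exists (x, r).
  have [x' xx' [e e0 eT]] : exists2 x', nrm (x' - x) < r &
      exists2 e : F, 0 < e & forall y, nrm (x' - y) < e -> n%:R < nrm (T y).
    apply: contrapT => nex'; apply: nex; exists n, x, r => // x' xx' e e0.
    apply: contrapT => ney; apply: nex'; exists x' => //; exists e => // y x'y.
    by rewrite ltNge; apply/negP => le; apply: ney; exists y.
  exists (x', Num.min (r / 2) (e / 3)) => _ /=.
  have m1 : Num.min (r / 2) (e / 3) <= r / 2 by rewrite ge_min lexx.
  have m2 : Num.min (r / 2) (e / 3) <= e / 3 by rewrite ge_min lexx orbT.
  split=> //; first by rewrite lt_min; apply/andP; split; lra.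
    exact: ltW.
  by move=> y yle; apply: eT; lra.
(* Radii are kept small enough for the limit, at distance at most twice the
   radius from the n-th centre, to stay in the zone avoiding the n-th set. *)
have [next nextP] := choice avoid.
pose s := fix s n := if n is m.+1 then next (m, (s m).1, (s m).2) else (0, 1) : X * F.
have s0 n : 0 < (s n).2.
  elim: n => [|n IH] /=; first exact: ltr01.
  by have [] := nextP (n, (s n).1, (s n).2) IH.
have [l lP] : exists l, forall n, nrm (l - (s n).1) <= 2 * (s n).2.
  apply: fast_cauchy => // n /=.
    by have [] := nextP (n, (s n).1, (s n).2) (s0 n).
  by have [] := nextP (n, (s n).1, (s n).2) (s0 n).
pose n := (Num.trunc (nrm (T l))).+1.
have [_ _ _ /(_ l)] := nextP (n, (s n).1, (s n).2) (s0 n).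
rewrite nrm_sub => /(_ (lP n.+1)) /=.
by have := truncnS_gt (nrm (T l)); rewrite -/n; lra.
Qed.

(** Subtracting the centre moves the good ball to the origin, and homogeneity
    spreads the estimate to all vectors: every x is a limit of vectors y with
    |T y| <= C |x|. *)
Lemma closed_graph_near : exists2 C : F, 0 < C & forall x (e : F), 0 < e ->
  exists2 y, nrm (x - y) < e & nrm (T y) <= C * nrm x.
Proof.
have [n [x0 [r r0 nP]]] := closed_graph_baire.
pose c : F := 2 * n%:R + 1; have c0 : 0 < c.
  by rewrite /c; have : 0 <= n%:R :> F by []; lra.
have ballP x (e : F) : nrm x < r -> 0 < e ->
    exists2 y, nrm (x - y) < e & nrm (T y) <= c.
  move=> xr e0.
  have [||y1 xy1 Ty1] := nP (x + x0) _ (e / 2); rewrite ?addrK//; first lra.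
  have [||y2 xy2 Ty2] := nP x0 _ (e / 2); rewrite ?subrr ?nrm0//; first lra.
  exists (y1 - y2).
    have -> : x - (y1 - y2) = (x + x0 - y1) - (x0 - y2).
      by rewrite -{1}(addrK x0 x) !opprB addrACA [RHS]addrACA [- y1 - x0]addrC.
    by have := nrmB (x + x0 - y1) (x0 - y2); lra.
  by rewrite linB//; have := nrmB (T y1) (T y2); rewrite /c; lra.
exists (2 * c / r) => [|x e e0]; first by rewrite divr_gt0// mulr_gt0.
have [->|x0'] := eqVneq x 0.
  by exists 0; rewrite ?subrr ?nrm0// lin0// nrm0 mulr0.
have x0x : 0 < nrm x by rewrite nrm_gt0.
pose t := r / (2 * nrm x).
have t0 : 0 < t by rewrite divr_gt0// mulr_gt0.
have tne : ofS k t != 0 by rewrite -abs_gt0 abs_ofS normr_gt0 gt_eqF.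
have tx : t * nrm x = r / 2 by rewrite /t; field; rewrite gt_eqF.
have [||y xy Ty] := ballP (ofS k t *: x) (t * e).
- by rewrite nrmZ abs_ofS gtr0_norm// tx; lra.
- exact: mulr_gt0.
have tE z : nrm (ofS k t *: z) = t * nrm z by rewrite nrmZ abs_ofS gtr0_norm.
exists ((ofS k t)^-1 *: y).
  rewrite -(ltr_pM2l t0); apply: le_lt_trans xy.
  by rewrite -tE scalerBr scalerA mulfV// scale1r.
rewrite linZ// -(ler_pM2l t0) -tE scalerA mulfV// scale1r (le_trans Ty)//.
by rewrite mulrCA tx le_eqVlt; apply/orP; left; apply/eqP; field; rewrite gt_eqF.
Qed.

(** Successive approximation: replacing x by x - y, with y given by the previous
    lemma, halves the remainder u n each time, and T (u n) is a Cauchy sequence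
    whose total variation is a multiple of |x|.  Its limit is 0 because the
    graph is closed. *)
Theorem closed_graph : bounded_map T.
Proof.
have [C C0 near] := closed_graph_near.
exists (2 * C) => x; have [->|x0'] := eqVneq x 0.
  by rewrite lin0// nrm0 mulr0.
have x0x : 0 < nrm x by rewrite nrm_gt0.
pose rho n := nrm x * 2^-1 ^+ n.
have rho0 n : 0 < rho n by rewrite mulr_gt0// exprn_gt0// invr_gt0.
have rhoS n : rho n.+1 = rho n / 2 by rewrite /rho exprSr mulrA.
have nearp (p : X * F) : exists y, 0 < p.2 ->
    nrm (p.1 - y) < p.2 /\ nrm (T y) <= C * nrm p.1.
  case: (ltP 0 p.2) => [p0|_]; last by exists 0.
  by have [y ? ?] := near p.1 p.2 p0; exists y.
have [g gP] := choice nearp.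
pose u := fix u n := if n is m.+1 then u m - g (u m, rho m.+1) else x.
have uS n : nrm (u n.+1) < rho n.+1 by have [] := gP (u n, rho n.+1) (rho0 _).
have un n : nrm (u n) <= rho n.
  by case: n => [|n]; [rewrite /rho expr0 mulr1|exact/ltW/uS].
have [|||w wP] := fast_cauchy (u := T \o u) (r := fun n => C * rho n).
- by move=> n; rewrite mulr_gt0.
- by move=> n; rewrite rhoS mulrA.
- move=> n /=; rewrite linB// addrC addKr nrmN.
  have [_ /=] := gP (u n, rho n.+1) (rho0 _); move/le_trans; apply.
  by rewrite ler_pM2l.
suff w0 : w = 0.
  have := wP 0%N; rewrite w0 sub0r nrmN /= /rho expr0 mulr1; lra.
apply: closedT => e e0.
have [n ne] :=
  half_exp_small (divr_gt0 e0 (mulr_gt0 (addr_gt0 ltr01 (addr_gt0 C0 C0)) x0x)).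
have re : (1 + (C + C)) * rho n < e.
  by rewrite /rho mulrA mulrC -ltr_pdivlMr// mulr_gt0// !addr_gt0.
have Crho : 0 < C * rho n by rewrite mulr_gt0.
exists (u n); first by have := un n; lra.
by rewrite nrm_sub; have := wP n; have := rho0 n; rewrite /=; lra.
Qed.

End ClosedGraph.

(** * The Hahn-Banach theorem *)

Section HahnBanachReal.
Variables (F : realType) (V : lmodType F) (p : V -> F).
Hypothesis pD : forall x y, p (x + y) <= p x + p y.
Hypothesis pZ : forall a x, p (a *: x) = `|a| * p x.

(** A partially defined linear functional is represented by its graph, a linear
    subspace of V * F, so that the order of Zorn's lemma is inclusion.  Being
    dominated by the seminorm p forces such a subspace to be a graph. *)
Definition linear_graph (G : set (V * F)) :=
  G (0, 0) /\ forall a u v, G u -> G v -> G (a *: u.1 + v.1, a * u.2 + v.2).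

Definition dominated (G : set (V * F)) := forall u, G u -> u.2 <= p u.1.

Lemma linear_graphZ G a u : linear_graph G -> G u -> G (a *: u.1, a * u.2).
Proof. by move=> [G0 GL] Gu; have := GL a u (0, 0) Gu G0; rewrite /= !addr0. Qed.

(** The value at v0 may be any number between the two families of bounds; the
    subadditivity of p says exactly that no lower bound exceeds an upper one. *)
Lemma extension_value G v0 : linear_graph G -> dominated G ->
  exists c, forall u, G u -> u.2 - p (u.1 - v0) <= c <= p (u.1 + v0) - u.2.
Proof.
move=> [G0 GL] dG.
have cross u w : G u -> G w -> u.2 - p (u.1 - v0) <= p (w.1 + v0) - w.2.
  move=> Gu Gw; have := dG _ (GL 1 u w Gu Gw); rewrite /= scale1r mul1r.
  have := pD (u.1 - v0) (w.1 + v0); rewrite addrACA addNr addr0; lra.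
pose S := [set s | exists2 u, G u & s = u.2 - p (u.1 - v0)].
have ubS w : G w -> ubound S (p (w.1 + v0) - w.2).
  by move=> Gw _ [u Gu ->]; exact: cross.
exists (sup S) => u Gu; apply/andP; split.
  apply: ub_le_sup; last by exists u.
  by exists (p (u.1 + v0) - u.2); exact: ubS.
by apply: ge_sup (ubS _ Gu); exists (u.2 - p (u.1 - v0)), u.
Qed.

Lemma dominated_extension G v0 : linear_graph G -> dominated G ->
  exists2 c, linear_graph [set u | exists a w, G w /\ u = (w.1 + a *: v0,
    w.2 + a * c)] &
    dominated [set u | exists a w, G w /\ u = (w.1 + a *: v0, w.2 + a * c)].
Proof.
move=> lG dG; have [c cP] := extension_value v0 lG dG; have [G0 GL] := lG.
exists c.
  split; first by exists 0, (0, 0); rewrite scale0r mul0r !addr0.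
  move=> a _ _ [b [u [Gu ->]]] [d [w [Gw ->]]].
  exists (a * b + d), (a *: u.1 + w.1, a * u.2 + w.2); split; first exact: GL.
  by rewrite /= scalerDr scalerA scalerDl addrACA; congr (_, _); ring.
move=> _ [a [w [Gw ->]]] /=.
have [a0|a0|->] := ltrgtP a 0; last first.
- by rewrite scale0r mul0r !addr0; exact: dG.
(* For a <> 0 the bound is the one for +v0 or -v0, rescaled by |a|. *)
- have /cP/andP[_] := linear_graphZ a^-1 lG Gw.
  have -> : w.1 + a *: v0 = a *: (a^-1 *: w.1 + v0).
    by rewrite scalerDr scalerA mulfV ?scale1r ?gt_eqF.
  rewrite pZ gtr0_norm// => /(ler_wpM2l (ltW a0)) /=.
  by rewrite mulrBr mulVKf ?gt_eqF//; lra.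
- have b0 : 0 < - a by lra.
  have /cP/andP[+ _] := linear_graphZ (- a)^-1 lG Gw.
  have -> : w.1 + a *: v0 = (- a) *: ((- a)^-1 *: w.1 - v0).
    by rewrite scalerBr scalerA mulfV ?scale1r ?gt_eqF// scaleNr opprK.
  rewrite pZ [X in _ <= X * _]gtr0_norm// => /(ler_wpM2l (ltW b0)) /=.
  by rewrite mulrBr mulVKf ?gt_eqF//; lra.
Qed.

Theorem hahn_banach_graph G0 : linear_graph G0 -> dominated G0 ->
  exists g : V -> F, [/\ scalar g, forall x, g x <= p x &
    forall u, G0 u -> g u.1 = u.2].
Proof.
move=> lG0 dG0.
pose good A := [/\ G0 `<=` A, linear_graph A & dominated A].
(* The empty set is admitted because it is the union of the empty chain. *)
pose ok A := A = set0 \/ good A.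
have [|A [[A0|[GA lA dA]] Amax]] := @Zorn_bigcup _ ok.
- move=> C Cgood tot.
  have [[A CA gA]|none] := pselect (exists2 A, C A & good A); last first.
    left; rewrite -subset0 => u [A CA Au].
    have [A0|gA] := Cgood A CA; first by rewrite A0 in Au.
    by case: none; exists A.
  right; have [GA lA _] := gA.
  have goodC u B : C B -> B u -> good B.
    by move=> CB Bu; have [B0|//] := Cgood B CB; rewrite B0 in Bu.
  split=> [u G0u||u [B CB Bu]]; first by exists A => //; exact: GA.
    split=> [|a u v [B CB Bu] [B' CB' B'v]]; first by exists A => //; exact: lA.1.
    have [BB'|B'B] := tot B B' CB CB'.
      by exists B' => //; have [_ [_ +] _] := goodC _ _ CB' B'v; apply=> //; exact: BB'.
    by exists B => //; have [_ [_ +] _] := goodC _ _ CB Bu; apply=> //; exact: B'B.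
  by have [_ _] := goodC _ _ CB Bu; apply.
- case: (Amax G0); last by right; split.
  by rewrite A0; split=> // /(_ (0, 0) lG0.1).
have total v0 : exists c, A (v0, c).
  have [c lB dB] := dominated_extension v0 lA dA.
  set B := [set _ | _] in lB dB.
  have AB : A `<=` B by move=> u Au; exists 0, u;
    rewrite scale0r mul0r !addr0 -surjective_pairing.
  exists c; apply: contrapT => nA; apply: (Amax B); last first.
    by right; split=> //; exact: subset_trans AB.
  split=> // BA; apply: nA; apply: BA; exists 1, (0, 0).
  by rewrite scale1r mul1r !add0r; split=> //; exact: lA.1.
have [g gA] := choice total.
have gfun u : A u -> g u.1 = u.2.
  have le a w : A w -> A (w.1, a) -> a <= w.2.
    move=> Aw Aa; have := dA _ (lA.2 (-1) _ _ Aw Aa).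
    rewrite /= scaleN1r addNr mulN1r.
    by have := pZ 0 0; rewrite scale0r normr0 mul0r => ->; lra.
  move=> Au; apply/eqP; rewrite eq_le (le _ u)//= -?surjective_pairing//.
  by rewrite (le u.2 (u.1, g u.1))//= -surjective_pairing.
exists g; split=> [a x y|x|u /GA]; last exact: gfun.
  by have := gfun _ (lA.2 a _ _ (gA x) (gA y)).
exact: dA _ (gA x).
Qed.

End HahnBanachReal.

(** A complex vector space seen as a real one, under a new name so that both
    module structures can be used. *)
Definition restrict_scalars (F : realType) (V : lmodType F[i]) : Type := V.

Section RestrictScalars.
Variables (F : realType) (V : lmodType F[i]).
HB.instance Definition _ := GRing.Zmodule.on (restrict_scalars V).

Let scale (a : F) (x : restrict_scalars V) : restrict_scalars V := a%:C%C *: (x : V).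

Fact restrict_scaleA a b v : scale a (scale b v) = scale (a * b) v.
Proof. by rewrite /scale scalerA rmorphM. Qed.
Fact restrict_scale1 : left_id 1 scale.
Proof. by move=> v; rewrite /scale rmorph1 scale1r. Qed.
Fact restrict_scaleDr : right_distributive scale +%R.
Proof. by move=> a u v; rewrite /scale scalerDr. Qed.
Fact restrict_scaleDl v : {morph scale^~ v : a b / a + b}.
Proof. by move=> a b; rewrite /scale rmorphD scalerDl. Qed.

HB.instance Definition _ := GRing.Zmodule_isLmodule.Build F (restrict_scalars V)
  restrict_scaleA restrict_scale1 restrict_scaleDr restrict_scaleDl.

Lemma restrict_scaleE (a : F) (x : V) : a *: (x : restrict_scalars V) = a%:C%C *: x.
Proof. by []. Qed.
End RestrictScalars.

Lemma normc_i (R : rcfType) : `|'i%C : R[i]| = 1.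
Proof. by rewrite normc_def /= expr0n expr1n add0r sqrtr1. Qed.

Section HahnBanach.
Variables (F : realType).

Definition bounded_functional k (X : normedModType (scalars F k)) (f : X ->
  scalars F k) :=
  scalar f /\ exists C : F, forall x, abs (f x) <= C * nrm x.

(** On M + K x0, the functional m + z x0 |-> z is bounded because x0 has positive
    distance from M. *)
Lemma closed_subspace_gap k (X : normedModType (scalars F k)) (M : set X) x0 :
  closed_subspace M -> ~ M x0 ->
  exists2 d : F, 0 < d & forall z m, M m -> abs z <= d * nrm (m + z *: x0).
Proof.
move=> [[M0 ML] cM] /(closed_gap cM)[d d0 dP].
exists d^-1; first by rewrite invr_gt0.
move=> z m Mm; rewrite -(ler_pM2l d0) mulVKf ?gt_eqF//.
have [->|z0] := eqVneq z 0.
  by rewrite abs0 mulr0 nrm_ge0.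
have -> : m + z *: x0 = z *: (x0 - - z^-1 *: m).
  by rewrite scaleNr opprK scalerDr scalerA mulfV// scale1r addrC.
rewrite nrmZ mulrC ler_pM2l ?abs_gt0//; apply: dP.
by have := ML (- z^-1) m 0 Mm M0; rewrite addr0.
Qed.

(** The real case is the dominated extension of m + z x0 |-> z.  In the complex
    case one extends its real part to a real functional g, and
    g x - i g (i x) is the complex functional with real part g. *)
Lemma separating_functional k (X : normedModType (scalars F k)) (M : set X) x0 :
  closed_subspace M -> ~ M x0 ->
  exists f, [/\ bounded_functional f, forall m, M m -> f m = 0 & f x0 = 1].
Proof.
move=> cM Mx0; have [d d0 dP] := closed_subspace_gap cM Mx0.
have [[M0 ML] _] := cM.
case: k X M x0 cM Mx0 dP M0 ML => X M x0 cM Mx0 dP M0 ML.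
  have [||||g [sg gp gG]] := @hahn_banach_graph F X (fun x => d * nrm x) _ _
    [set u | exists m z, M m /\ u = (m + z *: x0, z)].
  - by move=> x y; rewrite -mulrDr ler_wpM2l ?nrmD// ltW.
  - by move=> a x; rewrite nrmZ mulrCA.
  - split; first by exists 0, 0; rewrite scale0r addr0.
    move=> a _ _ [m [z [Mm ->]]] [m' [z' [Mm' ->]]].
    exists (a *: m + m'), (a * z + z'); split; first exact: ML.
    by rewrite /= scalerDr scalerA scalerDl addrACA.
  - by move=> _ [m [z [Mm ->]]] /=; apply: le_trans (dP _ _ Mm); exact: ler_norm.
  exists g; split.
  - split=> //; exists d => x; rewrite /abs /= ler_norml gp andbT.
    have gN : g (- x) = - g x by exact: (@linN _ X F^o g sg).
    by rewrite lerNl; have := gp (- x); rewrite nrmN gN.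
  - by move=> m Mm; apply: (gG (m, 0)); exists m, 0; rewrite scale0r addr0.
  - by apply: (gG (x0, 1)); exists 0, 1; rewrite scale1r add0r.
pose V := restrict_scalars X.
have [||||g [sg gp gG]] := @hahn_banach_graph F V (fun x => d * nrm (x : X)) _ _
    [set u | exists m z, M m /\ u = (m + z *: x0, complex.Re z)].
- by move=> x y; rewrite -mulrDr ler_wpM2l ?nrmD// ltW.
- move=> a x; rewrite restrict_scaleE nrmZ mulrCA; congr (_ * _).
  exact: (abs_ofS ComplexScalars a).
- split; first by exists 0, 0; rewrite scale0r addr0.
  move=> a _ _ [m [z [Mm ->]]] [m' [z' [Mm' ->]]].
  exists (a%:C%C *: m + m'), (a%:C%C * z + z'); split; first exact: ML.
  rewrite /= restrict_scaleE scalerDr scalerA scalerDl addrACA; congr (_, _).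
  by rewrite raddfD /=; case: (z) => ? ? /=; rewrite mul0r subr0.
- move=> _ [m [z [Mm ->]]] /=; apply: le_trans (dP _ _ Mm).
  rewrite -(ler_ofS ComplexScalars) ofS_abs; apply: le_trans (normc_ge_Re z).
  by rewrite lecR ler_norm.
have gD (x y : X) : g (x + y) = g x + g y := @linD _ V F^o g sg x y.
have gZ a (x : X) : g (a%:C%C *: x) = a * g x := @linZ _ V F^o g sg a x.
have gN (x : X) : g (- x) = - g x := @linN _ V F^o g sg x.
have ZE (z : F[i]) (x : X) : z *: x =
    (complex.Re z)%:C%C *: x + (complex.Im z)%:C%C *: ('i%C *: x).
  rewrite scalerA -scalerDl; congr (_ *: _).
  by case: z => a b; apply/eqP; rewrite eq_complex /=; apply/andP; split;
    apply/eqP; ring.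
have giZ (z : F[i]) (x : X) : g (z *: x) = complex.Re z * g x + complex.Im z * g ('i%C *: x).
  by rewrite [in LHS]ZE gD !gZ.
exists (fun x => (g x +i* - g ('i%C *: x))%C); split.
- split.
    move=> z x y; apply/eqP;
      rewrite eq_complex !scalerDr !gD scalerA (giZ z) (giZ ('i%C * z)).
    by case: z => a b /=; apply/andP; split; apply/eqP; ring.
  exists (2 * d) => x.
  have gabs y : `|g y| <= d * nrm (y : X).
    by rewrite ler_norml gp andbT lerNl; have := gp (- y); rewrite nrmN gN.
  have gi : `|g ('i%C *: x)| <= d * nrm x.
    apply: le_trans (gabs _) _; rewrite nrmZ /abs normc_i.
    by rewrite /= mul1r.
  pose i : scalars F ComplexScalars := 'i%C.
  have -> : (g x +i* - g ('i%C *: x))%C =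
      ofS ComplexScalars (g x) + i * ofS ComplexScalars (- g ('i%C *: x)).
    by apply/eqP; rewrite eq_complex /=; apply/andP; split; apply/eqP; ring.
  have absi : abs i = 1 by rewrite /abs normc_i.
  have := absD (ofS ComplexScalars (g x)) (i * ofS ComplexScalars (- g ('i%C *: x))).
  by rewrite absM !abs_ofS absi mul1r normrN; have := gabs x; lra.
- move=> m Mm; apply/eqP; rewrite eq_complex /=.
  rewrite (gG (m, 0)); last by exists m, 0; rewrite scale0r addr0.
  rewrite (gG ('i%C *: m, 0)) ?oppr0 ?eqxx//.
  by exists ('i%C *: m), 0; rewrite scale0r addr0; split=> //;
    rewrite -[_ *: _]addr0; exact: ML.
- apply/eqP; rewrite eq_complex /=.
  rewrite (gG (x0, 1)); last by exists 0, 1; rewrite scale1r add0r.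
  rewrite (gG ('i%C *: x0, 0)) ?oppr0 ?eqxx//.
  by exists 0, 'i%C; rewrite add0r.
Qed.

End HahnBanach.

(** * Nests and their rank one operators *)

Section Subspaces.
Variables (F : realType) (k : scalar_kind).
Variable X : normedModType (scalars F k).
Implicit Types M L : set X.

Lemma subspace0 M : linear_subspace M -> M 0. Proof. by case. Qed.

Lemma subspaceD M x y : linear_subspace M -> M x -> M y -> M (x + y).
Proof. by move=> [_ ML] Mx My; have := ML 1 x y Mx My; rewrite scale1r. Qed.

Lemma subspaceZ M a x : linear_subspace M -> M x -> M (a *: x).
Proof. by move=> [M0 ML] Mx; have := ML a x 0 Mx M0; rewrite addr0. Qed.

Lemma subspaceB M x y : linear_subspace M -> M x -> M y -> M (x - y).
Proof. by move=> lM Mx My; apply: subspaceD => //; rewrite -scaleN1r;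
  exact: subspaceZ. Qed.

Lemma subspace_sum M n (a : 'I_n -> scalars F k) (v : 'I_n -> X) :
  linear_subspace M -> (forall i, M (v i)) -> M (\sum_(i < n) a i *: v i).
Proof.
move=> lM Mv; elim/big_ind: _ => [|x y|i _]; first exact: subspace0.
  exact: subspaceD.
exact: subspaceZ.
Qed.

Lemma closed_join_le (G : set (set X)) M : closed_subspace M ->
  (forall L, G L -> L `<=` M) -> closed_join G `<=` M.
Proof.
move=> [lM cM] GM x /closureP xG; apply: closedP => // e /xG[_ [n [a [v [vG ->]]]]].
move=> lt; exists (\sum_(i < n) a i *: v i) => //; apply: subspace_sum => // i.
by have [L GL] := vG i; exact: GM.
Qed.

Lemma le_closed_join (G : set (set X)) L : G L -> L `<=` closed_join G.
Proof.
move=> GL x Lx; apply: subset_closure; exists 1%N, (fun=> 1), (fun=> x).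
by rewrite big_ord1 scale1r; split=> // _; exists L.
Qed.

(** The union of a chain of subspaces is already a subspace, so the vectors of
    the join are limits of vectors of single members. *)
Lemma chain_join_near (G : set (set X)) x :
  (forall L, G L -> linear_subspace L) ->
  (forall L M, G L -> G M -> L `<=` M \/ M `<=` L) -> G !=set0 ->
  closed_join G x -> forall e : F, 0 < e ->
  exists2 y, (exists2 L, G L & L y) & nrm (x - y) < e.
Proof.
move=> Gl Gc [L0 GL0] /closureP xG e /xG[_ [n [a [v [vG ->]]]]] lt.
exists (\sum_(i < n) a i *: v i) => //.
elim/big_ind: _ => [|y z [L GL Ly] [M GM Mz]|i _].
- by exists L0 => //; apply: subspace0; exact: Gl.
- have [LM|ML] := Gc L M GL GM.
    by exists M => //; apply: subspaceD => //; [exact: Gl|exact: LM].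
  by exists L => //; apply: subspaceD => //; [exact: Gl|exact: ML].
- by have [L GL Lv] := vG i; exists L => //; apply: subspaceZ => //; exact: Gl.
Qed.

End Subspaces.

Section Nest.
Variables (F : realType) (k : scalar_kind).
Variable X : normedModType (scalars F k).
Variable N : nest X.
Implicit Types (M L : set X) (A B : nest_alg N) (x y v : X).
Local Notation K := (scalars F k).

Lemma nest_lin M : N M -> linear_subspace M. Proof. by case/nest_closed. Qed.

Lemma nest_predN M : N M -> N (nest_pred N M).
Proof. by move=> NM; apply: nest_join => L []. Qed.

Lemma nest_pred_sub M : N M -> nest_pred N M `<=` M.
Proof. by move=> NM; apply: closed_join_le => [|L [_ []]//];
  exact: (nest_closed NM). Qed.

Lemma le_nest_pred M L : N L -> L `<` M -> L `<=` nest_pred N M.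
Proof. by move=> NL LM; apply: le_closed_join; split. Qed.

Lemma nest_pred_near M x : N M -> (exists2 u, M u & u != 0) -> nest_pred N M x ->
  forall e : F, 0 < e ->
  exists2 y, (exists2 L, N L /\ L `<` M & L y) & nrm (x - y) < e.
Proof.
move=> NM [u Mu u0]; apply: chain_join_near.
- by move=> L [/nest_lin].
- by move=> L L' [NL _] [NL' _]; exact: (nest_chain NL NL').
exists [set 0]; split; first exact: nest0.
split=> [_ ->|/(_ u Mu) /= /eqP]; last by rewrite (negPf u0).
by apply: subspace0; exact: nest_lin.
Qed.

Lemma algP A : [/\ linear A, bounded_map A & forall M, N M -> forall x, M x -> M (A x)].
Proof. by have /nest_operatorP[/bounded_mapP[? ?] ?] := nest_algP A. Qed.

Lemma alg_lin A : linear A. Proof. by case: (algP A). Qed.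

Lemma alg_stable A M x : N M -> M x -> M (A x).
Proof. by case: (algP A) => _ _ + NM; apply. Qed.

Lemma algD A B x : (A + B) x = A x + B x. Proof. by []. Qed.
Lemma algB A B x : (A - B) x = A x - B x. Proof. by []. Qed.
Lemma algZ (a : K) A x : (a *: A) x = a *: A x. Proof. by []. Qed.
Lemma algM A B x : (A * B) x = A (B x). Proof. by []. Qed.
Lemma alg0 x : (0 : nest_alg N) x = 0. Proof. by []. Qed.

Lemma alg_ext A B : A =1 B -> A = B.
Proof. by move=> AB; apply: val_inj; apply/funext. Qed.

Lemma alg_bound A : exists2 C : F, 0 < C & forall x, nrm (A x) <= C * nrm x.
Proof. by have [_ bA _] := algP A; exact: bounded_map_gt0. Qed.

Lemma alg_make (g : X -> X) : linear g -> bounded_map g ->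
  (forall M, N M -> forall x, M x -> M (g x)) -> exists A : nest_alg N, A =1 g.
Proof.
move=> lg bg gN.
have gP : g \in nest_operator N by apply/nest_operatorP; split=> //; exact/bounded_mapP.
by exists (NestAlg gP).
Qed.

(** With f vanishing on M_- and x in M, the operator v |-> f v *: x preserves
    every member of the nest: those containing M contain its range, and the
    others are contained in M_-, where f vanishes. *)
Definition admissible M (f : X -> K) :=
  [/\ N M, bounded_functional f & forall x, nest_pred N M x -> f x = 0].

(** The operator v |-> f v *: x, usually written as a tensor product of x and f.
    It is total, with the value 0 when that operator is not in the algebra, so
    that no proof of membership has to be carried along. *)
Definition rank_one x (f : X -> K) : nest_alg N := insubd 0 (fun v => f v *: x).

Lemma rank_oneE M f x : admissible M f -> M x -> rank_one x f =1 (fun v => f v *: x).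
Proof.
move=> [NM [lf [C fC]] fM] Mx v; rewrite /rank_one.
suff gP : (fun v => f v *: x) \in nest_operator N.
  by have := insubdK (0 : nest_alg N) gP => /(congr1 (fun h => h v)).
apply/nest_operatorP; split.
  apply/bounded_mapP; split=> [a u w|]; first by rewrite lf scalerDl scalerA.
  by exists (C * nrm x) => u; rewrite nrmZ mulrAC ler_wpM2r ?nrm_ge0.
move=> L NL u Lu; have [ML|nML] := pselect (M `<=` L).
  by apply: subspaceZ; [exact: nest_lin|exact: ML].
rewrite fM ?scale0r; first by apply: subspace0; exact: nest_lin.
apply: le_nest_pred Lu => //; split=> //.
by have [] := nest_chain NM NL.
Qed.

Lemma admissible_perp M f : N M -> bounded_functional f ->
  (forall x, M x -> f x = 0) -> admissible M f.
Proof. by move=> NM bf fM; split=> // x /(nest_pred_sub NM); exact: fM. Qed.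

(** Rank one operators of the algebra separate the points of X.  Let M be the
    least member containing w.  If w is not in M_-, a functional vanishing on
    M_- and not at w does.  Otherwise w is a limit of vectors of members L
    strictly below M; these do not contain w, and a functional vanishing on such
    an L, with a nonzero vector of L as range, does. *)
Lemma separation w : w != 0 ->
  exists M x f, [/\ admissible M f, M x, x != 0 & f w = 1].
Proof.
move=> w0; pose M := \bigcap_(L in [set L | N L /\ L w]) L.
have NM : N M by apply: nest_bigcap => L [].
have Mw : M w by move=> L [].
have [Mpw|Mpw] := pselect (nest_pred N M w); last first.
  have [f [bf fM fw]] := separating_functional (nest_closed (nest_predN NM)) Mpw.
  by exists M, w, f.
have [||y [L [NL [_ ML]] Ly] wy] := nest_pred_near NM _ Mpw (e := nrm w).
- by exists w.
- by rewrite nrm_gt0.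
have nLw : ~ L w by move=> Lw; apply: ML => u; apply.
have [f [bf fL fw]] := separating_functional (nest_closed NL) nLw.
exists L, y, f; split=> //; first exact: admissible_perp.
by apply: contraTneq wy => ->; rewrite subr0 ltxx.
Qed.

End Nest.

(** * Maps vanishing on zero products, and rank one operators *)

Section RankOne.
Variables (F : realType) (k : scalar_kind).
Variable X : completeNormedModType (scalars F k).
Variable N : nest X.
Implicit Types (M L : set X) (A B C E P : nest_alg N) (x y v : X).
Implicit Types (f g : X -> scalars F k).

Lemma alg_scaleAr (a : scalars F k) A B : A * (a *: B) = a *: (A * B).
Proof. by apply: alg_ext => v; rewrite !(algM, algZ) linZ//; exact: alg_lin. Qed.

Lemma alg_scaleAl (a : scalars F k) A B : (a *: A) * B = a *: (A * B).
Proof. by apply: alg_ext => v; rewrite !(algM, algZ). Qed.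

Lemma rank_one_mull A M f x : admissible N M f -> M x ->
  A * rank_one N x f = rank_one N (A x) f.
Proof.
move=> af Mx; apply: alg_ext => v.
rewrite algM !(rank_oneE af)// ?linZ//; first exact: alg_lin.
by have [NM _ _] := af; exact: alg_stable.
Qed.

Lemma rank_oneD M f x y : admissible N M f -> M x -> M y ->
  rank_one N (x + y) f = rank_one N x f + rank_one N y f.
Proof.
move=> af Mx My; have [NM _ _] := af; apply: alg_ext => v.
by rewrite algD !(rank_oneE af)// ?scalerDr//; apply: subspaceD => //;
  exact: nest_lin NM.
Qed.

Lemma rank_oneZ M f (a : scalars F k) x : admissible N M f -> M x ->
  rank_one N (a *: x) f = a *: rank_one N x f.
Proof.
move=> af Mx; have [NM _ _] := af; apply: alg_ext => v.
rewrite algZ !(rank_oneE af)// ?scalerA 1?mulrC//.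
by apply: subspaceZ => //; exact: nest_lin NM.
Qed.

(** The projection on M along a closed complement has a closed graph, hence is
    bounded; it preserves each member of the nest because that member either
    lies in M, where the projection is the identity, or contains M. *)
Lemma complemented_projection M : N M -> complemented M ->
  exists P : nest_alg N, (forall x, M (P x)) /\ forall x, M x -> P x = x.
Proof.
move=> NM [L [[lL cL] ML0 dec]]; have lM := nest_lin NM; have [_ cM] := nest_closed NM.
have uniq y z y' z' : M y -> L z -> M y' -> L z' -> y + z = y' + z' -> y = y'.
  move=> My Lz My' Lz' e; apply/eqP; rewrite -subr_eq0; apply/eqP.
  have : (M `&` L) (y - y'); last by rewrite ML0.
  split; first exact: subspaceB.
  have -> : y - y' = z' - z by apply/eqP; rewrite subr_eq addrAC -subr_eq opprK e addrC.
  exact: subspaceB.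
have [p pP] : exists p : X -> X, forall x, M (p x) /\ L (x - p x).
  have [p pP] := choice dec; exists p => x; have [z [Mp Lz e]] := pP x.
  by split=> //; rewrite {1}e addrAC subrr add0r.
have linp : linear p.
  move=> a x y; apply: (uniq _ (a *: x + y - p (a *: x + y)) _
      (a *: (x - p x) + (y - p y))).
  - by case: (pP (a *: x + y)).
  - by case: (pP (a *: x + y)).
  - by apply: subspaceD => //; [apply: subspaceZ => //; case: (pP x)|case: (pP y)].
  - by apply: subspaceD => //; [apply: subspaceZ => //; case: (pP x)|case: (pP y)].
  - by rewrite [LHS]addrC subrK addrACA -scalerDr [p x + _]addrC [p y + _]addrC !subrK.
have pM x : M x -> p x = x.
  move=> Mx; have [Mp Lp] := pP x; apply: (uniq _ (x - p x) _ 0) => //.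
    exact: subspace0.
  by rewrite addr0 addrC subrK.
have bp : bounded_map p.
  apply: closed_graph => // w wP.
  have : (M `&` L) w; last by rewrite ML0.
  split; apply: closedP => // e e0.
    by have [x _ xw] := wP e e0; exists (p x); [case: (pP x)|rewrite nrm_sub].
  have [|x xe xw] := wP (e / 2); first lra.
  exists (p x - x); first by rewrite -opprB -scaleN1r; apply: subspaceZ => //;
    case: (pP x).
  rewrite opprB addrA addrAC; have := nrmD (w - p x) x; rewrite (nrm_sub w); lra.
have [|P PE] := @alg_make F k X N p linp bp.
  move=> L' NL' x L'x; have [LM|ML'] := nest_chain NL' NM.
    by rewrite pM//; exact: LM.
  by apply: ML'; case: (pP x).
by exists P; split=> x; rewrite PE; [case: (pP x)|exact: pM].
Qed.

End RankOne.

Section BalancedElements.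
Variables (R : pzRingType) (delta tau : {additive R -> R}).
Hypothesis zero_product : forall A B : R, A * B = 0 -> delta A * B + A * tau B = 0.
Implicit Types A B C E P Q : R.

(** C may be moved across the form (A, B) |-> delta(A) B + A tau(B). *)
Definition balanced C := forall A B,
  delta (A * C) * B + A * C * tau B = delta A * (C * B) + A * tau (C * B).

(** Apply the hypothesis to the zero products (A E) ((1 - E) B) and
    (A (1 - E)) (E B), and compare. *)
Lemma balanced_idem E : E * E = E -> balanced E.
Proof.
move=> EE A B.
have H1 : delta (A * E) * (B - E * B) + A * E * tau (B - E * B) = 0.
  by apply: zero_product; rewrite mulrBr -!mulrA (mulrA E) EE subrr.
have H2 : delta (A - A * E) * (E * B) + (A - A * E) * tau (E * B) = 0.
  by apply: zero_product; rewrite mulrBl -!mulrA (mulrA E) EE subrr.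
move/eqP: H1; rewrite raddfB !mulrBr addrACA -opprD subr_eq0 => /eqP ->.
by move/eqP: H2; rewrite raddfB !mulrBl addrACA -opprD subr_eq0 => /eqP ->.
Qed.

Lemma balancedB C E : balanced C -> balanced E -> balanced (C - E).
Proof.
move=> bC bE A B; rewrite mulrBr mulrBl !raddfB /= !mulrBl !mulrBr.
by rewrite addrACA [RHS]addrACA -!opprD bC bE.
Qed.

Lemma balancedM C E : balanced C -> balanced E -> balanced (C * E).
Proof.
by move=> bC bE A B; rewrite [A * (C * E)]mulrA bE bC !mulrA.
Qed.

(** Under these relations P + Q is again an idempotent, and Q is the difference
    of two idempotents. *)
Lemma balanced_square0 P Q : P * P = P -> P * Q = Q -> Q * P = 0 -> balanced Q.
Proof.
move=> PP PQ QP; have QQ : Q * Q = 0 by rewrite -{2}PQ mulrA QP mul0r.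
rewrite -[Q](addrK P); apply: balancedB; apply: balanced_idem => //.
by rewrite mulrDl !mulrDr PP PQ QP QQ !add0r.
Qed.

(** Subtracting the multiplications by delta 1 and tau 1 turns delta and tau into
    maps that agree on balanced elements and satisfy the Leibniz rule there. *)
Definition delta0 A := delta A - delta 1 * A.
Definition tau0 A := tau A - A * tau 1.

Lemma delta0E C : balanced C -> delta0 C = tau0 C.
Proof.
move=> /(_ 1 1); rewrite !mul1r !mulr1 => e.
by apply/eqP; rewrite subr_eq addrAC -subr_eq opprK e addrC.
Qed.

Lemma delta0M A C : balanced C -> delta0 (A * C) = delta0 A * C + A * delta0 C.
Proof.
move=> bC; have := bC A 1; rewrite !mulr1 => e.
rewrite (delta0E bC) /delta0 /tau0 mulrBl mulrBr.
by rewrite addrACA -e addrACA !mulrA subrr addr0.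
Qed.

Lemma tau0M B C : balanced C -> tau0 (C * B) = delta0 C * B + C * tau0 B.
Proof.
move=> bC; have := bC 1 B; rewrite !mul1r => e.
by rewrite /delta0 /tau0 mulrBl mulrBr addrACA e addrACA !mulrA subrr add0r.
Qed.

End BalancedElements.

Section ZeroProducts.
Variables (F : realType) (k : scalar_kind).
Variable X : completeNormedModType (scalars F k).
Variable N : nest X.
Hypothesis Ncompl : forall M : set X, N M -> nest_pred N M = M -> complemented M.
Variables delta tau : {linear nest_alg N -> nest_alg N}.
Hypothesis zero_product :
  forall A B : nest_alg N, A * B = 0 -> delta A * B + A * tau B = 0.
Implicit Types (M L : set X) (A B C E P Q : nest_alg N) (x y z v : X).
Implicit Types (f g : X -> scalars F k).

Lemma balancedZ (a : scalars F k) C : balanced delta tau C ->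
  balanced delta tau (a *: C).
Proof.
have dZ B : delta (a *: B) = a *: delta B by exact: linearZZ.
have tZ B : tau (a *: B) = a *: tau B by exact: linearZZ.
move=> bC A B; rewrite alg_scaleAr !alg_scaleAl alg_scaleAr /= dZ tZ.
by rewrite !alg_scaleAr !alg_scaleAl -!scalerDr bC.
Qed.

Lemma rank_one_idem M f x : admissible N M f -> M x -> f x = 1 ->
  rank_one N x f * rank_one N x f = rank_one N x f.
Proof. by move=> af Mx fx;
  rewrite (rank_one_mull _ af)// (rank_oneE af)// fx scale1r. Qed.

(** When f x <> 0 the operator is a multiple of an idempotent.  When f x = 0, add
    to x a vector z of M with f z <> 0. *)
Lemma balanced_rank_one_ne0 M f x z : admissible N M f -> M x -> M z -> f z != 0 ->
  balanced delta tau (rank_one N x f).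
Proof.
move=> af Mx Mz fz; have [NM [lf _] _] := af.
have ne0 u : M u -> f u != 0 -> balanced delta tau (rank_one N u f).
  move=> Mu fu; have Mfu : M ((f u)^-1 *: u) by apply: subspaceZ => //;
    exact: nest_lin NM.
  rewrite -[u](scalerKV fu) (rank_oneZ _ af)//;
    apply/balancedZ/(balanced_idem zero_product).
  apply: (rank_one_idem af) => //.
  by rewrite (@linZ _ X (scalars F k)^o f lf) /GRing.scale /= mulVf.
have [fx|fx] := eqVneq (f x) 0; last exact: ne0.
have Mxz : M (x + z) by apply: subspaceD => //; exact: nest_lin NM.
have -> : rank_one N x f = rank_one N (x + z) f - rank_one N z f.
  by rewrite (rank_oneD af)// addrK.
apply: balancedB; apply: ne0 => //.
by rewrite (@linD _ X (scalars F k)^o f lf) fx add0r.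
Qed.

(** The remaining case is that of f vanishing on M.  If M_- = M, the projection P
    on M satisfies P Q = Q and Q P = 0 for Q the given operator.  If M_- <> M,
    there is an idempotent of rank one with range in M, by a vector z and a
    functional g; it plays the part of P for v |-> f v *: z, and the given
    operator is a product through z. *)
Lemma balanced_rank_one M f x : admissible N M f -> M x ->
  balanced delta tau (rank_one N x f).
Proof.
move=> af Mx; have [NM [lf _] _] := af.
have [[z Mz fz]|f0] := pselect (exists2 z, M z & f z != 0).
  exact: balanced_rank_one_ne0 af Mx Mz fz.
have {}f0 z : M z -> f z = 0.
  by move=> Mz; apply/eqP/negPn/negP => fz; apply: f0; exists z.
have [/(Ncompl NM)/(complemented_projection NM)[P [PM PE]]|nM] :=
  pselect (nest_pred N M = M).
  apply: (balanced_square0 (P := P) zero_product); apply: alg_ext => v.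
  - by rewrite algM PE.
  - by rewrite algM PE// (rank_oneE af)//; apply: subspaceZ => //; exact: nest_lin NM.
  - by rewrite algM (rank_oneE af)// f0// scale0r.
have [z Mz nz] : exists2 z, M z & ~ nest_pred N M z.
  apply: contrapT => nz; apply: nM; apply/seteqP; split=> z; first exact: nest_pred_sub.
  by move=> Mz; apply: contrapT => nMz; apply: nz; exists z.
have [g [bg gM gz]] := separating_functional (nest_closed (nest_predN NM)) nz.
have ag : admissible N M g by split.
have -> : rank_one N x f = rank_one N x g * rank_one N z f.
  by rewrite (rank_one_mull _ af)// (rank_oneE ag)// gz scale1r.
apply: balancedM; first by apply: (balanced_rank_one_ne0 ag Mx Mz);
  rewrite gz oner_neq0.
apply: (balanced_square0 (P := rank_one N z g) zero_product).
- exact: rank_one_idem ag Mz gz.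
- by rewrite (rank_one_mull _ af)// (rank_oneE ag)// gz scale1r.
- by rewrite (rank_one_mull _ ag)// (rank_oneE af)// f0// scale0r;
     apply: alg_ext => v; rewrite (rank_oneE ag) ?scaler0//; apply: subspace0;
       exact: nest_lin NM.
Qed.

Lemma delta0_lin : linear (delta0 delta).
Proof.
have dP a A B : delta (a *: A + B) = a *: delta A + delta B by exact: linearP.
move=> a A B; rewrite /delta0 /= dP mulrDr alg_scaleAr scalerBr opprD.
by rewrite addrACA.
Qed.

(** Once delta0 is the derivation given by S, so is tau0: for C of rank one, the
    rules for delta0 (C B) and tau0 (C B) give C (tau0 B - delta0 B) = 0, and
    rank one operators separate points. *)
Lemma tau0_inner (S : nest_alg N) : (forall A, delta0 delta A = S * A - A * S) ->
  forall B, tau0 tau B = S * B - B * S.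
Proof.
move=> inner B; rewrite -inner; apply: alg_ext => v.
apply/eqP; rewrite -subr_eq0; apply/negPn/negP => w0.
have [M [x [f [af Mx x0 fw]]]] := separation N w0.
have [NM [lf [Cf fC]] fM] := af.
pose fB (u : X) := f (B u).
have afB : admissible N M fB.
  split=> // [|u Mu]; last by apply: fM; apply: alg_stable Mu; exact: nest_predN.
  split=> [a u1 u2|]; first by rewrite /fB (alg_lin B) lf.
  have [CB _ BC] := alg_bound B; exists (`|Cf| * CB) => u.
  apply: le_trans (fC _) _; rewrite -mulrA.
  apply: (@le_trans _ _ (`|Cf| * nrm (B u))).
    by apply: ler_wpM2r; [exact: nrm_ge0|exact: ler_norm].
  by apply: ler_wpM2l.
pose C := rank_one N x f.
have CBE : C * B = rank_one N x fB.
  by apply: alg_ext => u; rewrite algM (rank_oneE af)// (rank_oneE afB).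
have bCB : balanced delta tau (C * B) by rewrite CBE; exact: balanced_rank_one afB Mx.
have bC : balanced delta tau C by exact: balanced_rank_one af Mx.
have : delta0 delta (C * B) = delta0 delta C * B + C * delta0 delta B.
  by rewrite !inner mulrBl mulrBr !mulrA addrA subrK.
rewrite (delta0E bCB) (tau0M B bC) => /addrI /(congr1 (fun A => A v)).
rewrite !algM !(rank_oneE af)// => e.
case/eqP: x0; rewrite -[x]scale1r -fw (@linB _ X (scalars F k)^o f lf) scalerBl.
by rewrite e subrr.
Qed.

End ZeroProducts.

(** * Implementing a derivation on the members of the nest *)

Section LocalImplementation.
Variables (F : realType) (k : scalar_kind).
Variable X : completeNormedModType (scalars F k).
Variable N : nest X.
Variable D : nest_alg N -> nest_alg N.
Hypothesis D_lin : linear D.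
Hypothesis D_rank_one : forall A M f x, admissible N M f -> M x ->
  D (A * rank_one N x f) = D A * rank_one N x f + A * D (rank_one N x f).
Implicit Types (M L : set X) (A B : nest_alg N) (x y z v w : X).
Implicit Types (f g : X -> scalars F k) (S : X -> X).
Local Notation rk := (rank_one N).

(** Evaluating the Leibniz rule at y shows that x |-> D (rk x f) y implements D
    on M. *)
Lemma D_intertwine A M f x y : admissible N M f -> M x -> f y = 1 ->
  D (rk (A x) f) y = D A x + A (D (rk x f) y).
Proof.
move=> af Mx fy; rewrite -(rank_one_mull A af Mx) (D_rank_one A af Mx).
by rewrite algD !algM (rank_oneE af)// fy scale1r.
Qed.

(** Two such implementing maps differ by a scalar: factor rk x f as
    rk x g * rk v f.  The scalar g (D (rk v f) y) does not depend on x. *)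
Lemma D_transfer L x g v M f y : admissible N L g -> L x -> g v = 1 ->
  admissible N M f -> M x -> M v -> f y = 1 ->
  D (rk x f) y = D (rk x g) v + g (D (rk v f) y) *: x.
Proof.
move=> ag Lx gv af Mx Mv fy.
have -> : rk x f = rk (rk x g v) f by rewrite (rank_oneE ag)// gv scale1r.
by rewrite (D_intertwine (rk x g) af Mv fy) (rank_oneE ag).
Qed.

(** The scalar c absorbs the freedom in the choice of f and y. *)
Definition locally_implements S M := exists f y (c : scalars F k),
  [/\ f y = 1, admissible N M f & forall x, M x -> S x = D (rk x f) y + c *: x].

Lemma local_intertwine S M A x : locally_implements S M -> M x ->
  S (A x) = D A x + A (S x).
Proof.
move=> [f [y [c [fy af SE]]]] Mx; have [NM _ _] := af.
rewrite !SE//; last exact: alg_stable.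
by rewrite (D_intertwine A af Mx fy) (linD (alg_lin A)) (linZ (alg_lin A)) addrA.
Qed.

(** By the transfer formula, S x is D (rk x g) v up to a multiple of x, where v may
    be chosen in M, so that D (rk x g) v is in M too.  This needs g with
    g v = 1 that is admissible for a member containing x: M itself if
    M_- <> M, and otherwise a smaller member, whence the limit argument. *)
Lemma local_invariant S M x : linear S -> bounded_map S -> locally_implements S M ->
  M x -> M (S x).
Proof.
move=> lS /bounded_map_gt0[C C0 SC] [f [y [c [fy af SE]]]] Mx; have [NM _ _] := af.
have lM := nest_lin NM; have [_ cM] := nest_closed NM.
have inv L g u v : admissible N L g -> L u -> M u -> M v -> g v = 1 -> M (S u).
  move=> ag Lu Mu Mv gv; rewrite SE//; apply: subspaceD => //; last exact: subspaceZ.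
  rewrite (D_transfer ag Lu gv af Mu Mv fy).
  by apply: subspaceD => //; [exact: alg_stable|exact: subspaceZ].
have [[u Mu u0]|M0] := pselect (exists2 u, M u & u != 0); last first.
  have -> : x = 0 by apply/eqP/negPn/negP => x0; apply: M0; exists x.
  by rewrite (lin0 lS); exact: subspace0.
have [Mpx|nMpx] := pselect (M `<=` nest_pred N M); last first.
  have [z Mz nz] : exists2 z, M z & ~ nest_pred N M z.
    apply: contrapT => nz; apply: nMpx => z Mz.
    by apply: contrapT => nMz; apply: nz; exists z.
  have [g [bg gM gz]] := separating_functional (nest_closed (nest_predN NM)) nz.
  by apply: (inv M g x z) => //; split.
apply: closedP => // e e0.
have [||x' [L [NL [LM ML]] Lx'] xx'] := nest_pred_near NM _ (Mpx _ Mx) (e := e / C).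
- by exists u.
- by rewrite divr_gt0.
exists (S x'); last first.
  rewrite -linB//; apply: le_lt_trans (SC _) _.
  by rewrite mulrC -ltr_pdivlMr.
have [v Mv Lv] : exists2 v, M v & ~ L v.
  apply: contrapT => nv; apply: ML => v Mv.
  by apply: contrapT => nLv; apply: nv; exists v.
have [g [bg gL gv]] := separating_functional (nest_closed NL) Lv.
by apply: (inv L g x' v) => //; [exact: admissible_perp|exact: LM].
Qed.

Lemma inner_of_local S : linear S -> bounded_map S ->
  (forall M, N M -> M <> setT -> locally_implements S M) ->
  (forall x (e : F), 0 < e -> exists2 x', nrm (x - x') < e &
     exists2 M, locally_implements S M & M x') ->
  exists T : nest_alg N, forall A, D A = T * A - A * T.
Proof.
move=> lS bS Sloc Sdense; have [|T TE] := @alg_make F k X N S lS bS.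
  move=> M NM x Mx; have [->//|MT] := pselect (M = setT).
  exact: (local_invariant lS bS (Sloc M NM MT) Mx).
exists T => A; apply: alg_ext => x; apply/eqP; rewrite -subr_eq0; apply/eqP.
set B := D A - (T * A - A * T); have -> : D A x - (T * A - A * T) x = B x by [].
have [C C0 BC] := alg_bound B.
apply: nrm_small => e e0.
have [|x' xx' [M Mloc Mx']] := Sdense x (e / C); first by rewrite divr_gt0.
have Bx' : B x' = 0.
  rewrite /B !(algB, algM) !TE (local_intertwine A Mloc Mx').
  by rewrite addrK subrr.
rewrite -[B x]subr0 -Bx' -(linB (alg_lin B)); apply: le_trans (BC _) _.
by rewrite mulrC -ler_pdivlMr// ltW.
Qed.

(** If X_- <> X, a functional f vanishing on X_- makes rk x f available for all x,
    and S x = D (rk x f) y implements D everywhere.  Its graph is closed: if x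
    tends to 0 and S x to w, then for R = rk z g one has
    R (S x) = g x *: S z - D R x, hence R w = 0, and separation gives w = 0. *)
Lemma inner_of_proper_last : nest_pred N setT <> setT ->
  exists T : nest_alg N, forall A, D A = T * A - A * T.
Proof.
move=> nT; have [y ny] : exists y, ~ nest_pred N setT y.
  apply: contrapT => ny; apply: nT; apply/seteqP; split=> // y _.
  by apply: contrapT => nMy; apply: ny; exists y.
have NT := nestT N.
have [f [bf fT fy]] := separating_functional (nest_closed (nest_predN NT)) ny.
have af M : N M -> admissible N M f.
  move=> NM; split=> // x Mx; apply: fT.
  have [<-//|MT] := pselect (M = setT).
  apply: (le_nest_pred NM _ (nest_pred_sub NM Mx)); split=> // TM.
  by apply: MT; apply/seteqP; split.
pose S x := D (rk x f) y.
have lS : linear S.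
  move=> a x x'; rewrite /S (rank_oneD (af _ NT))// (rank_oneZ _ (af _ NT))//.
  by rewrite D_lin.
have Sloc M : N M -> locally_implements S M.
  move=> NM; exists f, y, 0; split=> // [|x Mx]; first exact: af.
  by rewrite scale0r addr0.
apply: (@inner_of_local S) => // [|M NM _|x e e0]; last 2 first.
- exact: Sloc.
- exists x; first by rewrite subrr nrm0.
  by exists setT => //; exact: Sloc.
apply: closed_graph => // w wP; apply/eqP/negPn/negP => w0.
have [M [z [g [ag Mz z0 gw]]]] := separation N w0.
have [_ [lg [Cg gC]] _] := ag.
pose R := rk z g; have [CR CR0 RC] := alg_bound R.
have [CD CD0 DC] := alg_bound (D R).
have Rw : R w = z by rewrite /R (rank_oneE ag)// gw scale1r.
have RS x : R (S x) = g x *: S z - D R x.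
  have := local_intertwine R (Sloc _ NT) (I : setT x).
  rewrite {1}/R (rank_oneE ag)// linZ// => ->.
  by rewrite [D R x + _]addrC addrK.
pose C : F := CR + (`|Cg| * nrm (S z) + CD).
have C0 : 0 < C.
  by have := mulr_ge0 (normr_ge0 Cg) (nrm_ge0 (S z)); rewrite /C; lra.
case/eqP: z0; apply: nrm_small => e e0.
have [|x xe xw] := wP (e / C); first by rewrite divr_gt0.
have -> : z = (g x *: S z - D R x) - R (S x - w).
  by rewrite (linB (alg_lin R)) RS Rw opprB addrCA subrr addr0.
have gx : abs (g x) <= `|Cg| * nrm x.
  by apply: le_trans (gC x) _; apply: ler_wpM2r; [exact: nrm_ge0|exact: ler_norm].
have h1 := nrmB (g x *: S z - D R x) (R (S x - w)).
have h2 := nrmB (g x *: S z) (D R x).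
have h3 := RC (S x - w); have h4 := DC x.
have h5 : nrm (g x *: S z) <= `|Cg| * nrm (S z) * nrm x.
  by rewrite nrmZ mulrAC; apply: ler_wpM2r => //; exact: nrm_ge0.
have h6 : CR * nrm (S x - w) <= CR * (e / C) by rewrite ler_pM2l// ltW.
have h7 : (`|Cg| * nrm (S z) + CD) * nrm x <= (`|Cg| * nrm (S z) + CD) * (e / C).
  apply: ler_wpM2l; last exact: ltW.
  by apply: addr_ge0; [apply: mulr_ge0 => //; exact: nrm_ge0|exact: ltW].
have eE : CR * (e / C) + (`|Cg| * nrm (S z) + CD) * (e / C) = e.
  by rewrite -mulrDl -/C mulrC divfK// gt_eqF.
lra.
Qed.

End LocalImplementation.

(** * Limits of operators and extension by continuity *)

Section Limits.
Variables (F : realType) (k : scalar_kind).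
Variable X : completeNormedModType (scalars F k).

Lemma nrm_exp_small (x : X) (c : F) :
  (forall n, nrm x <= c * 2^-1 ^+ n) -> x = 0.
Proof.
move=> xc; have c0 : 0 <= c.
  by apply: le_trans (nrm_ge0 x) _; have := xc 0%N; rewrite expr0 mulr1.
apply: nrm_small => e e0; have c1 : 0 < c + 1 by lra.
have [n ne] := half_exp_small (divr_gt0 e0 c1).
apply: le_trans (xc n) _; rewrite mulrC; move: ne; rewrite ltr_pdivlMr//.
have : 0 <= 2^-1 ^+ n :> F by rewrite exprn_ge0 ?invr_ge0.
by set t := 2^-1 ^+ n; lra.
Qed.

Lemma alg_limit (N : nest X) (A_ : nat -> nest_alg N) :
  (forall n u, nrm (A_ n.+1 u - A_ n u) <= 2^-1 ^+ n * nrm u) ->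
  exists A : nest_alg N, forall n u, nrm (A u - A_ n u) <= 2 * nrm u * 2^-1 ^+ n.
Proof.
move=> Acauchy.
have [l lP] : exists l : X -> X, forall u n,
  nrm (l u - A_ n u) <= 2 * nrm u * 2^-1 ^+ n.
  suff /choice[l lP] : forall u, exists l, forall n,
      nrm (l - A_ n u) <= 2 * nrm u * 2^-1 ^+ n by exists l.
  move=> u; have [->|u0] := eqVneq u 0.
    exists 0 => n; rewrite (lin0 (alg_lin _)) subrr nrm0 mulr0 mul0r.
    exact: lexx.
  have nu : 0 < nrm u by rewrite nrm_gt0.
  have [|||l lP] := fast_cauchy (u := fun n => A_ n u) (r :=
    fun n => nrm u * 2^-1 ^+ n).
  - by move=> n; rewrite mulr_gt0// exprn_gt0// invr_gt0.
  - by move=> n; rewrite exprSr mulrA.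
  - by move=> n; rewrite mulrC.
  - by exists l => n; rewrite -mulrA.
have ll : linear l.
  move=> a x y; apply/eqP; rewrite -subr_eq0; apply/eqP.
  apply: (@nrm_exp_small _ (2 * nrm (a *: x + y) + abs a * (2 * nrm x) + 2 * nrm y)).
  move=> n; have e : l (a *: x + y) - (a *: l x + l y) =
      (l (a *: x + y) - A_ n (a *: x + y)) - (a *: (l x - A_ n x) + (l y - A_ n y)).
    rewrite (alg_lin (A_ n)) scalerBr (addrACA (a *: l x)) -[- (a *: A_ n x) - _]opprD.
    by rewrite opprB addrA subrK.
  rewrite e; apply: le_trans (nrmB _ _) _.
  have h1 := nrmD (a *: (l x - A_ n x)) (l y - A_ n y).
  have h2 := lP x n; have h3 := lP y n; have h4 := lP (a *: x + y) n.
  rewrite nrmZ in h1; have := ler_wpM2l (abs_ge0 a) h2; rewrite mulrA => h5.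
  by rewrite !mulrDl; lra.
have bl : bounded_map l.
  have [C C0 CP] := alg_bound (A_ 0%N); exists (C + 2) => u.
  have := nrm_tri (A_ 0%N u) (l u) 0; rewrite !subr0.
  by have := lP u 0%N; have := CP u; rewrite expr0; lra.
have [|A AE] := @alg_make F k X N l ll bl.
  move=> M NM x Mx; have [_ cM] := nest_closed NM.
  apply: closedP => // e e0; have p : 0 < 2 * nrm x + 1 by have := nrm_ge0 x; lra.
  have [n ne] := half_exp_small (divr_gt0 e0 p).
  exists (A_ n x); first exact: alg_stable.
  apply: le_lt_trans (lP x n) _; move: ne; rewrite ltr_pdivlMr//.
  have : 0 <= 2^-1 ^+ n :> F by rewrite exprn_ge0 ?invr_ge0.
  by set t := 2^-1 ^+ n; lra.
by exists A => n u; rewrite AE.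
Qed.

(** Extension by continuity of a bounded linear map with dense domain.  The map is
    given by its graph G, as it will be glued from maps on the members of a
    nest.  All properties of the extension follow from the single estimate
    |S x - u.2| <= C |x - u.1| for u in G, which also determines S x. *)
Lemma graph_closure (G : set (X * X)) (C : F) : 0 <= C ->
  (forall a u v, G u -> G v -> G (a *: u.1 + v.1, a *: u.2 + v.2)) ->
  (forall u, G u -> nrm u.2 <= C * nrm u.1) ->
  (forall x (e : F), 0 < e -> exists2 u, G u & nrm (x - u.1) < e) ->
  exists S : X -> X, [/\ linear S, bounded_map S & forall u, G u -> S u.1 = u.2].
Proof.
move=> C0 GL GC Gdense.
have GB u v : G u -> G v -> nrm (u.2 - v.2) <= C * nrm (u.1 - v.1).
  move=> Gu Gv; have := GC _ (GL (-1) v u Gv Gu).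
  by rewrite /= !scaleN1r ![- _ + _]addrC.
have [S SP] : exists S : X -> X, forall x u, G u ->
  nrm (S x - u.2) <= C * nrm (x - u.1).
  suff /choice[S SP] : forall x, exists s, forall u, G u ->
    nrm (s - u.2) <= C * nrm (x - u.1).
    by exists S.
  move=> x.
  have /choice[p pP] n : exists u, G u /\ nrm (x - u.1) < 2^-1 ^+ n.
    have [|u Gu xu] := Gdense x (2^-1 ^+ n); first by rewrite exprn_gt0// invr_gt0.
    by exists u.
  have C1 : 0 < C + 1 by lra.
  have t0 n : 0 < 2^-1 ^+ n :> F by rewrite exprn_gt0// invr_gt0.
  have [|||s sP] := fast_cauchy (u := fun n => (p n).2)
      (r := fun n => (2 * (C + 1)) * 2^-1 ^+ n).
  - by move=> n; rewrite mulr_gt0// mulr_gt0.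
  - by move=> n; rewrite exprSr mulrA.
  - move=> n; have [Gn xn] := pP n; have [GS xS] := pP n.+1.
    apply: le_trans (GB _ _ GS Gn) _.
    have h : nrm ((p n.+1).1 - (p n).1) <= 2 * 2^-1 ^+ n.
      have := nrm_tri x (p n.+1).1 (p n).1; rewrite (nrm_sub (p n.+1).1 x).
      have := t0 n; rewrite exprSr in xS; lra.
    have := ler_wpM2l C0 h; have := t0 n; set t := 2^-1 ^+ n => tp; lra.
  exists s => u Gu; apply/ler_addgt0Pr => e e0.
  have c0 : 0 < 5 * (C + 1) by lra.
  have [n ne] := half_exp_small (divr_gt0 e0 c0).
  rewrite ltr_pdivlMr// in ne.
  have [Gn xn] := pP n.
  have := nrm_tri (p n).2 s u.2; have := sP n; have := GB _ _ Gn Gu.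
  have h : nrm ((p n).1 - u.1) <= 2^-1 ^+ n + nrm (x - u.1).
    by have := nrm_tri x (p n).1 u.1; rewrite (nrm_sub (p n).1 x); lra.
  have := ler_wpM2l C0 h; have := t0 n; move: ne; set t := 2^-1 ^+ n; lra.
have SG u : G u -> S u.1 = u.2.
  move=> Gu; apply/eqP; rewrite -subr_eq0; apply/eqP/nrm_small => e e0.
  by have := SP u.1 u Gu; rewrite subrr nrm0 mulr0; lra.
exists S; split=> //; last first.
  have [u Gu _] := Gdense 0 1 ltr01.
  have G0 : G (0, 0) by have := GL (-1) u u Gu Gu; rewrite !scaleN1r !addNr.
  by exists C => x; have := SP x _ G0; rewrite !subr0.
move=> a x y; apply/eqP; rewrite -subr_eq0; apply/eqP/nrm_small => e e0.
pose K := 2 * C * (abs a + 1) + 1; have a0 := abs_ge0 a.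
have K0 : 0 < K by have := mulr_ge0 C0 a0; rewrite /K; lra.
have [|u Gu xu] := Gdense x (e / K); first by rewrite divr_gt0.
have [|v Gv yv] := Gdense y (e / K); first by rewrite divr_gt0.
have h1 := SP (a *: x + y) _ (GL a _ _ Gu Gv).
have h2 := SP x u Gu; have h3 := SP y v Gv.
have h4 : nrm (a *: x + y - (a *: u.1 + v.1)) <= abs a * nrm (x - u.1) + nrm (y - v.1).
  by rewrite opprD addrACA -scalerBr -nrmZ nrmD.
have h5 : nrm (a *: S x + S y - (a *: u.2 + v.2)) <= abs a * nrm (S x - u.2) + nrm (S y - v.2).
  by rewrite opprD addrACA -scalerBr -nrmZ nrmD.
have := nrm_tri (a *: u.2 + v.2) (S (a *: x + y)) (a *: S x + S y).
rewrite (nrm_sub (a *: u.2 + v.2)) => h6.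
have h7 := ler_wpM2l a0 h2; have h8 := ler_wpM2l C0 h4.
have h9 := ler_wpM2l C0 (ltW yv); have h10 := ler_wpM2l (mulr_ge0 C0 a0) (ltW xu).
have eE : K * (e / K) = e by rewrite mulrC divfK// gt_eqF.
have t0 : 0 < e / K by rewrite divr_gt0.
rewrite /= in h1 h6; rewrite -eE /K.
move: t0 h9 h10; set t := e / K => t0 h9 h10.
by rewrite mulrDl; lra.
Qed.

End Limits.

(** * Nests whose proper members are dense in the space *)

Section NoProperLast.
Variables (F : realType) (k : scalar_kind).
Variable X : completeNormedModType (scalars F k).
Variable N : nest X.
Variable D : nest_alg N -> nest_alg N.
Hypothesis D_lin : linear D.
Hypothesis D_rank_one : forall A M f x, admissible N M f -> M x ->
  D (A * rank_one N x f) = D A * rank_one N x f + A * D (rank_one N x f).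
Hypothesis no_last : nest_pred N setT = setT.
Hypothesis nontrivial : exists u : X, u != 0.
Implicit Types (M L : set X) (A B : nest_alg N) (x y z v w : X).
Implicit Types (f g : X -> scalars F k).
Local Notation rk := (rank_one N).

Definition proper M := N M /\ M <> setT.

Lemma proper_near x (e : F) : 0 < e ->
  exists2 y, (exists2 L, proper L & L y) & nrm (x - y) < e.
Proof.
move=> e0; have [u u0] := nontrivial.
have [||y [L [NL [_ TL]] Ly] xy] := nest_pred_near (nestT N) _ _ (x := x) e0.
- by exists u.
- by rewrite no_last.
exists y => //; exists L => //; split=> // LT; apply: TL.
by rewrite LT.
Qed.

Lemma proper_next M : proper M -> exists L y, [/\ proper L, M `<=` L, L y & ~ M y].
Proof.
move=> [NM MT]; have [u nu] : exists u, ~ M u.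
  apply: contrapT => nu; apply: MT; apply/seteqP; split=> // u _.
  by apply: contrapT => nMu; apply: nu; exists u.
have [_ cM] := nest_closed NM; have [d d0 dP] := closed_gap cM nu.
have [y [L pL Ly] uy] := proper_near u d0.
have nMy : ~ M y by move=> /dP; rewrite leNgt uy.
exists L, y; split=> //; have [NL _] := pL.
by have [//|LM] := nest_chain NM NL; case: nMy; exact: LM.
Qed.

Lemma proper_join M L : proper M -> proper L ->
  exists M', [/\ proper M', M `<=` M' & L `<=` M'].
Proof.
move=> pM pL; have [NM _] := pM; have [NL _] := pL.
by have [ML|LM] := nest_chain NM NL; [exists L; split|exists M; split].
Qed.

Definition normalized g M := [/\ bounded_functional g, forall x, M x -> g x = 0 &
  forall u, abs (g u) <= nrm u].

(** Take v in a proper member and almost maximizing |f v| / |v|, for some f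
    vanishing on M.  Proper members are dense, so the supremum over them is the
    norm of f, and rescaling f and v gives the constants 1 and 2. *)
Lemma proper_functional M : proper M -> exists g v, [/\ normalized g M, g v = 1,
  nrm v <= 2 & exists2 L, proper L & L v].
Proof.
move=> pM; have [NM _] := pM; have [L0 [y [pL0 _ Ly nMy]]] := proper_next pM.
have [f [[lf [C fC]] fM fy]] := separating_functional (nest_closed NM) nMy.
have lf' : linear (f : X -> (scalars F k)^o) := lf.
have f0 : f 0 = 0 := lin0 lf'.
have nz v : f v != 0 -> 0 < nrm v by rewrite nrm_gt0; apply: contra_neq => ->.
have fy0 : f y != 0 by rewrite fy oner_neq0.
pose Q := [set r | exists v, [/\ exists2 L, proper L & L v, f v != 0 &
  r = abs (f v) / nrm v]].
have Qsup : has_sup Q.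
  split; first by exists (abs (f y) / nrm y), y; split=> //; exists L0.
  by exists C => _ [v [_ fv ->]]; rewrite ler_pdivrMr ?nz.
have ubQ := sup_upper_bound Qsup.
have s0 : 0 < sup Q.
  apply: (@lt_le_trans _ _ (abs (f y) / nrm y)).
    by rewrite divr_gt0 ?abs_gt0 ?nz.
  by apply: ubQ; exists y; split=> //; exists L0.
have [|_ [v [X0v fv ->]] sv] := @sup_adherent _ Q (sup Q / 2) _ Qsup; first lra.
pose r := abs (f v) / nrm v.
have rs : sup Q < 2 * r by rewrite /r; lra.
have r0 : 0 < 2 * r by lra.
have fr u : abs (f u) <= 2 * r * nrm u.
  apply/ler_addgt0Pr => e e0.
  have K0 : 0 < 2 * r + `|C| by have := normr_ge0 C; lra.
  have [|u' X0u uu'] := proper_near u (e := e / (2 * r + `|C|));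
    first by rewrite divr_gt0.
  have fu' : abs (f u') <= 2 * r * nrm u'.
    have [->|fu'0] := eqVneq (f u') 0; first by rewrite abs0 mulr_ge0 ?nrm_ge0 ?ltW.
    rewrite -ler_pdivrMr ?nz//; apply: le_trans (ltW rs).
    by apply: ubQ; exists u'.
  have fuu' : abs (f u) <= abs (f u') + abs (f (u - u')).
    by apply: le_trans (absD _ _); rewrite (linB lf') addrC subrK.
  have fC' : abs (f (u - u')) <= `|C| * nrm (u - u').
    by apply: le_trans (fC _) _; apply: ler_wpM2r; [exact: nrm_ge0|exact: ler_norm].
  have nu' : nrm u' <= nrm u + nrm (u - u').
    by have := nrm_tri u u' 0; rewrite !subr0 (nrm_sub u'); lra.
  have h1 := ler_wpM2l (ltW r0) nu'.
  have h2 := ler_wpM2l (ltW K0) (ltW uu').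
  have eE : (2 * r + `|C|) * (e / (2 * r + `|C|)) = e by rewrite mulrC divfK// gt_eqF.
  by rewrite eE in h2; lra.
have nv := nz v fv.
pose c : scalars F k := (ofS k (2 * r)).
have c0 : c != 0 by rewrite -abs_gt0 abs_ofS normr_gt0 gt_eqF.
have cabs : abs c = 2 * r by rewrite abs_ofS gtr0_norm.
have cV u : abs (c^-1 * f u) <= nrm u.
  rewrite -(ler_pM2l r0) -{1}cabs -absM mulrA mulfV// mul1r; exact: fr.
exists (fun u => c^-1 * f u), ((c / f v) *: v); split.
- split=> //; last by move=> x Mx; rewrite fM// mulr0.
  split; last by exists 1 => u; rewrite mul1r.
  by move=> a x x'; rewrite lf; ring.
- have fZ a u : f (a *: u) = a * f u by exact: (linZ lf').
  by rewrite fZ divfK// mulVf.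
- have absV : abs (c / f v) * abs (f v) = 2 * r by rewrite -absM divfK.
  rewrite nrmZ -(ler_pM2l (_ : 0 < abs (f v))) ?abs_gt0//.
  rewrite mulrA [abs (f v) * _]mulrC absV /r.
  by rewrite le_eqVlt; apply/orP; left; apply/eqP; field; rewrite gt_eqF.
- by have [L pL Lv] := X0v; exists L => //; apply: subspaceZ => //;
  apply: nest_lin (proj1 pL).
Qed.

Definition rank_one_bound M0 (C : F) := forall M g x v, proper M -> M0 `<=` M ->
  normalized g M -> M x -> (exists2 L, proper L & L v) ->
  nrm (D (rk x g) v) <= C * nrm x * nrm v.

(** A local property of D: choosing f to vanish on L, with f y = 1, one has
    0 = D (rk (B v) f) y = D B v + B (D (rk v f) y), and the last vector is 0
    because D (rk v f) maps y into M. *)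
Lemma D_local_zero L M v y B : proper L -> proper M -> L `<=` M -> M y -> ~ L y ->
  L v ->
  (forall u, M u -> B u = 0) -> D B v = 0.
Proof.
move=> [NL _] [NM _] LM My nLy Lv B0.
have [f [bf fL fy]] := separating_functional (nest_closed NL) nLy.
have af := admissible_perp NL bf fL.
have D0 : D 0 = 0 := lin0 D_lin.
have rk0 : rk 0 f = 0.
  apply: alg_ext => u; rewrite (rank_oneE af) ?scaler0//.
  by apply: subspace0; exact: nest_lin NL.
have := D_intertwine D_rank_one B af Lv fy.
rewrite B0 ?rk0 ?D0 ?alg0; last exact: LM.
rewrite B0 ?addr0//; exact: alg_stable My.
Qed.

(** One step of a gliding hump.  If D is unbounded on rank one operators above
    every proper member, a small multiple of one of them can be added to A so
    that the image under D has norm larger than n |v| at some v, without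
    changing A on M.  By locality,
      later steps that do not change the operator on M' leave
    its image at v unchanged. *)
Lemma hump_step : (forall M C, proper M -> ~ rank_one_bound M C) ->
  forall M A n, proper M -> exists M' A',
  [/\ proper M' /\ M `<=` M', forall u, M u -> A' u = A u,
      forall u, nrm (A' u - A u) <= 2^-1 ^+ n * nrm u &
      exists v, n%:R * nrm v < nrm (D A' v) /\
        forall B, (forall u, M' u -> B u = 0) -> D B v = 0].
Proof.
move=> unbounded M A n pM; have [b b0 DAb] := alg_bound (D A).
pose t : F := 2^-1 ^+ n; have t0 : 0 < t by rewrite exprn_gt0// invr_gt0.
(* This constant compensates for the scaling by t and for the image of A. *)
pose C := t^-1 * (n%:R + b).
have [M1 [g [x [v [pM1 MM1 ng Mx [[L pL Lv] big]]]]]] : exists M1 g x v,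
   [/\ proper M1, M `<=` M1, normalized g M1, M1 x &
       (exists2 L, proper L & L v) /\ C * nrm x * nrm v < nrm (D (rk x g) v)].
  apply: contrapT => nex; apply: (unbounded M C pM) => M1 g x v pM1 MM1 ng Mx X0v.
  by rewrite leNgt; apply/negP => lt; apply: nex; exists M1, g, x, v.
have [NM1 _] := pM1; have [bg gM1 g1] := ng.
have ag := admissible_perp NM1 bg gM1.
have x0 : 0 < nrm x.
  rewrite nrm_gt0; apply/eqP => x0; move: big; rewrite x0 nrm0 mulr0 mul0r.
  have -> : rk 0 g = 0.
    apply: alg_ext => u; rewrite (rank_oneE ag) ?scaler0//.
    by apply: subspace0; exact: nest_lin NM1.
  by rewrite (lin0 D_lin) alg0 nrm0 ltxx.
pose c := t / nrm x; have c0 : 0 < c by rewrite divr_gt0.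
have [L1 [pL1 M1L1 LL1]] := proper_join pM1 pL.
have [M' [y [pM' L1M' M'y nL1y]]] := proper_next pL1.
exists M', (ofS k c *: rk x g + A); split.
- by split=> //; apply: subset_trans MM1 _; exact: subset_trans L1M'.
- move=> u Mu; rewrite algD algZ (rank_oneE ag)// gM1; last exact: MM1.
  by rewrite scale0r scaler0 add0r.
- move=> u; rewrite algD addrK algZ (rank_oneE ag)// !nrmZ abs_ofS gtr0_norm//.
  rewrite mulrCA /c divfK ?gt_eqF// mulrC.
  by apply: ler_wpM2l => //; exact: ltW.
exists v; split; last first.
  by move=> B; apply: (D_local_zero pL1 pM' L1M' M'y nL1y); exact: LL1.
rewrite D_lin algD algZ.
have h1 : (n%:R + b) * nrm v < nrm (ofS k c *: D (rk x g) v).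
  rewrite nrmZ abs_ofS gtr0_norm// -(ltr_pM2l c0) in big *.
  apply: le_lt_trans big; rewrite /C /c le_eqVlt; apply/orP; left; apply/eqP.
  by field; rewrite !gt_eqF.
have h2 := DAb v.
have := nrmB (ofS k c *: D (rk x g) v + D A v) (D A v); rewrite addrK.
by lra.
Qed.

(** The limit A of the gliding hump would have D A v_n of norm larger than
    n |v_n| for all n, although D A is bounded. *)
Lemma rank_one_bound_exists : exists M0 C, proper M0 /\ rank_one_bound M0 C.
Proof.
apply: contrapT => nex.
have unbounded M C : proper M -> ~ rank_one_bound M C.
  by move=> pM rb; apply: nex; exists M, C.
have pick (p : nat * set X * nest_alg N) : exists q : set X * nest_alg N,
    proper p.1.2 -> [/\ proper q.1 /\ p.1.2 `<=` q.1,
      forall u, p.1.2 u -> q.2 u = p.2 u,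
      forall u, nrm (q.2 u - p.2 u) <= 2^-1 ^+ p.1.1 * nrm u &
      exists v, p.1.1%:R * nrm v < nrm (D q.2 v) /\
        forall B, (forall u, q.1 u -> B u = 0) -> D B v = 0].
  case: p => -[n M] A /=; have [pM|npM] := pselect (proper M); last by exists (M, A).
  by have [M' [A' H]] := hump_step unbounded A n pM; exists (M', A').
have [next nextP] := choice pick.
pose s := fix s n : set X * nest_alg N :=
  if n is m.+1 then next (m, (s m).1, (s m).2) else ([set 0], 0).
have sp n : proper (s n).1.
  elim: n => [|n IH] /=; last by case: (nextP (n, (s n).1, (s n).2) IH) => -[].
  split; first exact: nest0.
  have [u u0] := nontrivial; move=> /(congr1 (fun Q => Q u)) /= e.
  by case/eqP: u0; rewrite -/([set 0] u) e.
have sP n := nextP (n, (s n).1, (s n).2) (sp n).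
have [A AP] : exists A : nest_alg N, forall n u,
    nrm (A u - (s n).2 u) <= 2 * nrm u * 2^-1 ^+ n.
  by apply: alg_limit => n u; have [_ _ + _] := sP n; apply.
have stable n m u : (s n).1 u -> (s (n + m)%N).1 u /\ (s (n + m)%N).2 u = (s n).2 u.
  move=> su; elim: m => [|m [IH1 IH2]]; first by rewrite addn0.
  by have [[_ sub] eq _ _] := sP (n + m)%N; rewrite addnS /= eq//; split=> //;
    exact: sub.
have Alim n u : (s n).1 u -> A u = (s n).2 u.
  move=> su; apply/eqP; rewrite -subr_eq0; apply/eqP.
  apply: (@nrm_exp_small _ _ _ _ (2 * nrm u)) => m.
  have [_ <-] := stable n m u su; apply: le_trans (AP _ _) _.
  apply: ler_wpM2l; first by rewrite mulr_ge0 ?nrm_ge0.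
  rewrite exprD ler_piMl ?exprn_ge0 ?invr_ge0//.
  by rewrite exprn_ile1 ?invr_ge0// invf_le1 ?ler1n.
have [b b0 DAb] := alg_bound (D A).
pose n := (Num.trunc b).+1; have bn : b < n%:R by exact: truncnS_gt.
have [_ _ _ [v [big zero]]] := sP n.
have DE : D A v = D (s n.+1).2 v.
  apply/eqP; rewrite -subr_eq0 -algB -(linB D_lin); apply/eqP; apply: zero => u su.
  by rewrite algB (Alim n.+1 u su) subrr.
have := DAb v; rewrite DE; move: big => /= big.
have := ler_wpM2r (nrm_ge0 v) (ltW bn); lra.
Qed.

(** Fix x0 in a proper member M0 and h with h x0 = 1.  Above M0, subtract from
    each implementing map x |-> D (rk x g) v the multiple of the identity that
    makes h vanish on the image of x0.  By the transfer formula the normalized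
    maps agree, so they glue to a map on the union of the proper members; the
    bounds above make it bounded, and it extends to X. *)
Lemma inner_of_no_last : exists T : nest_alg N, forall A, D A = T * A - A * T.
Proof.
have [M00 [C [pM00 rbC]]] := rank_one_bound_exists.
have [M0 [x0 [pM0 M00M0 M0x0 nx0]]] := proper_next pM00.
have x00 : x0 != 0.
  by apply: contra_notN nx0 => /eqP ->; apply: subspace0; apply: nest_lin (proj1 pM00).
have [h [[lh [H hH]] _ hx0]] : exists h, [/\ bounded_functional h,
    forall x, [set 0] x -> h x = 0 & h x0 = 1].
  by apply: separating_functional; [exact: nest_closed (nest0 N)|move=> /= e;
    case/eqP: x00].
have /choice[phi phiP] M : exists p : (X -> scalars F k) * X, proper M ->
    [/\ normalized p.1 M, p.1 p.2 = 1, nrm p.2 <= 2 & exists2 L, proper L & L p.2].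
  have [pM|npM] := pselect (proper M); last by exists (fun=> 0, 0).
  by have [g [v gv]] := proper_functional pM; exists (g, v).
pose T (p : (X -> scalars F k) * X) x := D (rk x p.1) p.2 - h (D (rk x0 p.1) p.2) *: x.
have aM g M : proper M -> normalized g M -> admissible N M g.
  by move=> [NM _] [bg gM _]; exact: admissible_perp.
(* Both the map and its normalizing term change by the same scalar. *)
have T_up M p L q x : proper M -> M0 `<=` M -> normalized p.1 M -> p.1 p.2 = 1 ->
    proper L -> M `<=` L -> L p.2 -> normalized q.1 L -> q.1 q.2 = 1 -> M x ->
    T q x = T p x.
  move=> pM M0M np pp pL ML Lp nq qq Mx; have M0x := M0M _ M0x0.
  rewrite /T (D_transfer D_rank_one (aM _ _ pM np) Mx pp (aM _ _ pL nq) (ML _ Mx) Lp qq).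
  rewrite (D_transfer D_rank_one (aM _ _ pM np) M0x pp (aM _ _ pL nq) (ML _ M0x) Lp qq).
  have -> a b : h (a + b *: x0) = h a + b.
    by rewrite addrC lh hx0 mulr1 addrC.
  by rewrite scalerDl opprD addrACA subrr addr0.
have T_compat M L x : proper M -> M0 `<=` M -> proper L -> M0 `<=` L -> M x -> L x ->
    T (phi M) x = T (phi L) x.
  move=> pM M0M pL M0L Mx Lx.
  have [np pp _ [M1 pM1 M1p]] := phiP M pM.
  have [nq qq _ [L1 pL1 L1q]] := phiP L pL.
  have [J1 [pJ1 MJ LJ]] := proper_join pM pL.
  have [J2 [pJ2 M1J L1J]] := proper_join pM1 pL1.
  have [J [pJ J1J J2J]] := proper_join pJ1 pJ2.
  have [nr rr _ _] := phiP J pJ.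
  rewrite -(T_up M (phi M) J (phi J) x)//.
  - by apply: (T_up L (phi L) J (phi J) x) => // [u Lu|]; [apply/J1J/LJ|apply/J2J/L1J].
  - by move=> u Mu; apply/J1J/MJ.
  - by apply/J2J/M1J.
have T_lin M : proper M -> forall a x y, M x -> M y ->
    T (phi M) (a *: x + y) = a *: T (phi M) x + T (phi M) y.
  move=> pM a x y Mx My; have [np _ _ _] := phiP M pM; have af := aM _ _ pM np.
  rewrite /T (rank_oneD af)//; last by apply: subspaceZ => //;
    apply: nest_lin (proj1 pM).
  rewrite (rank_oneZ _ af)// D_lin algD algZ scalerBr [RHS]addrACA -opprD.
  by rewrite scalerDr !scalerA [_ * a]mulrC.
pose K := `|C| * 2 + `|H| * (`|C| * nrm x0 * 2).
have T_bound M x : proper M -> M0 `<=` M -> M x -> nrm (T (phi M) x) <= K * nrm x.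
  move=> pM M0M Mx; have [np pp p2 X0p] := phiP M pM.
  have Dle z : M z -> nrm (D (rk z (phi M).1) (phi M).2) <= `|C| * nrm z * 2.
    move=> Mz; apply: le_trans (rbC M _ z _ pM _ np Mz X0p) _.
      exact: subset_trans M0M.
    apply: (@le_trans _ _ (`|C| * nrm z * nrm (phi M).2)).
      apply: ler_wpM2r; first exact: nrm_ge0.
      by apply: ler_wpM2r; [exact: nrm_ge0|exact: ler_norm].
    by apply: ler_wpM2l => //; rewrite mulr_ge0 ?nrm_ge0.
  have h1 := Dle x Mx; have h2 := Dle x0 (M0M _ M0x0).
  have h3 : abs (h (D (rk x0 (phi M).1) (phi M).2)) <= `|H| * (`|C| * nrm x0 * 2).
    apply: le_trans (hH _) _.
    apply: (@le_trans _ _ (`|H| * nrm (D (rk x0 (phi M).1) (phi M).2))).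
      by apply: ler_wpM2r; [exact: nrm_ge0|exact: ler_norm].
    exact: ler_wpM2l.
  apply: le_trans (nrmB _ _) _; rewrite nrmZ.
  by have := ler_wpM2r (nrm_ge0 x) h3; rewrite /K mulrDl; lra.
have [|||| S [lS bS SG]] := @graph_closure F k X
    [set u | exists M, [/\ proper M, M0 `<=` M, M u.1 & u.2 = T (phi M) u.1]] K.
- by rewrite /K addr_ge0 ?mulr_ge0 ?nrm_ge0.
- move=> a u v [M [pM M0M Mu eu]] [L [pL M0L Lv ev]] /=.
  have [J [pJ MJ LJ]] := proper_join pM pL.
  have M0J := subset_trans M0M MJ.
  exists J; split=> //=.
    by apply: (proj2 (nest_lin (proj1 pJ))); [exact: MJ|exact: LJ].
  rewrite T_lin//; [|exact: MJ|exact: LJ].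
  rewrite eu ev (T_compat M J)//; last exact: MJ.
  by rewrite (T_compat L J)//; exact: LJ.
- by move=> u [M [pM M0M Mu ->]]; exact: T_bound.
- move=> x e e0; have [y [L pL Ly] xy] := proper_near x e0.
  have [J [pJ LJ M0J]] := proper_join pL pM0.
  by exists (y, T (phi J) y) => //; exists J; split=> //; exact: LJ.
have Sloc M : proper M -> locally_implements D S M.
  move=> pM; have [J [pJ MJ M0J]] := proper_join pM pM0.
  have [[bf fJ f1] pp _ _] := phiP J pJ.
  exists (phi J).1, (phi J).2, (- h (D (rk x0 (phi J).1) (phi J).2)); split=> //.
    by apply: admissible_perp => // [|x Mx]; [exact: (proj1 pM)|apply/fJ/MJ].
  move=> x Mx; rewrite (SG (x, T (phi J) x)); last by exists J; split=> //; exact: MJ.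
  by rewrite /= /T scaleNr.
apply: (inner_of_local D_rank_one lS bS) => [M NM MT|x e e0].
  exact: Sloc.
have [y [L pL Ly] xy] := proper_near x e0.
by exists y => //; exists L => //; exact: Sloc.
Qed.

End NoProperLast.

(** * The characterization *)

Theorem corollary3p1 (F : realType) (k : scalar_kind)
    (X : completeNormedModType (scalars F k)) (dimX : dim_ge2 X)
    (N : nest X)
    (Ncompl : forall M : set X, N M -> nest_pred N M = M -> complemented M)
    (delta tau : {linear nest_alg N -> nest_alg N}) :
  (forall A B : nest_alg N, A * B = 0 -> delta A * B + A * tau B = 0) <->
  (exists R S T : nest_alg N, forall A : nest_alg N,
     delta A = R * A + A * S /\ tau A = - S * A + A * T).
Proof.
split=> [zp|[R [S [T ST]]] A B AB]; last first.
  have [-> _] := ST A; have [_ ->] := ST B.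
  rewrite mulrDl mulrDr -!mulrA AB mulr0 add0r mulNr mulrN addrA subrr add0r.
  by rewrite mulrA AB mul0r.
have nz : exists u : X, u != 0.
  have [u [v uv]] := dimX; exists u; apply/eqP => u0.
  have [] := uv 1 0; first by rewrite u0 scaler0 scale0r addr0.
  by move/eqP; rewrite oner_eq0.
have D_lin := delta0_lin delta.
have D_rank_one A M f x : admissible N M f -> M x ->
    delta0 delta (A * rank_one N x f) =
    delta0 delta A * rank_one N x f + A * delta0 delta (rank_one N x f).
  move=> af Mx; apply: (delta0M (tau := tau)).
  exact: (balanced_rank_one Ncompl zp af Mx).
have [S dS] : exists S : nest_alg N, forall A, delta0 delta A = S * A - A * S.
  have [last|no_last] := pselect (nest_pred N setT = setT).
    exact: inner_of_no_last D_lin D_rank_one last nz.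
  exact: inner_of_proper_last D_lin D_rank_one no_last.
have tS := tau0_inner Ncompl zp dS.
exists (delta 1 + S), (- S), (tau 1 - S) => A; split.
  by rewrite -[LHS](subrK (delta 1 * A)) -/(delta0 delta A) dS mulrDl mulrN addrC addrA.
rewrite -[LHS](subrK (A * tau 1)) -/(tau0 tau A) tS opprK mulrBr addrAC addrA.
by [].
Qed.
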